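(* Let $(X,\mu)$ be a standard probability space and let $T\in\mathrm{Aut}(X,\mu)$ be ergodic. Then the closure $\overline{D([T]_1)}$ in $[T]_1$ of the derived group of $[T]_1$ is equal to each of the following four groups: (i) the kernel of the index map $I:[T]_1\to\mathbb R$; (ii) the connected component of the identity in $[T]_1$; (iii) the subgroup of $[T]_1$ generated by the periodic elements of $[T]_1$; (iv) the subgroup of $[T]_1$ topologically generated by involutions, i.e. the closure in $[T]_1$ of the subgroup generated by the involutions of $[T]_1$.
   Context: A standard probability space $(X,\mu)$ is a standard Borel space with a non-atomic Borel probability measure. $\mathrm{Aut}(X,\mu)$ is the group of measure-preserving Borel bijections of $X$, identified when they agree almost everywhere. $T$ is ergodic if every Borel set which is a union of $T$-orbits has measure $0$ or $1$; it is aperiodic if a.e. orbit is infinite (ergodic implies aperiodic since $\mu$ is non-atomic). For aperiodic $T$, $[T]=\{U\in\mathrm{Aut}(X,\mu): U(x)\in\{T^n(x):n\in\mathbb Z\}\text{ for a.e. }x\}$, and each $U\in[T]$ has a cocycle $c_U:X\to\mathbb Z$ defined by $U(x)=T^{c_U(x)}(x)$. The $\mathrm L^1$ full group is $[T]_1=\{U\in[T]:\int_X|c_U|\,d\mu<+\infty\}$, with the topology induced by the metric $\tilde d_T(U,V)=\int_X|c_U-c_V|\,d\mu$. $D(G)$ denotes the derived (commutator) subgroup of a group $G$. The index map is $I(U)=\int_X c_U(x)\,d\mu(x)$. An element of $\mathrm{Aut}(X,\mu)$ is periodic if (almost) all its orbits are finite. An involution is an element $U$ with $U^2=\mathrm{id}_X$.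 *)

(* Defs.v *)
From HB Require Import structures.
From mathcomp Require Import all_boot all_order all_algebra.
From mathcomp Require Import all_classical all_reals all_analysis.
From mathcomp Require Import measurable_realfun.
From mathcomp Require Import zify.

Set Implicit Arguments.
Unset Strict Implicit.
Unset Printing Implicit Defensive.

Import Order.TTheory GRing.Theory Num.Theory.
Import numFieldNormedType.Exports.

Local Open Scope classical_set_scope.
Local Open Scope ring_scope.
Local Open Scope quotient_scope.

Section groups.
Variable G : groupType.

Definition subgroup (H : set G) : Prop := group_closed (mem H).

Definition generated_subgroup (S : set G) : set G := smallest subgroup S.

Definition derived_subgroup (H : set G) : set G :=
  generated_subgroup [set commg u v | u in H & v in H].

Definition is_involution (u : G) : Prop := (u * u = 1)%g.

End groups.

(* Polish spaces are the separable completely metrizable ones. *)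
Definition standard_borel (R : realType) d (X : measurableType d) : Prop :=
  exists (P : completePseudoMetricType R) (h : X -> P),
    [/\ hausdorff_space P, exists2 D : set P, countable D & dense D,
        bijective h &
        forall A : set X,
          measurable A <-> exists2 B, <<s @open P >> B & A = h @^-1` B].

Definition nonatomic (R : realType) d (X : measurableType d)
    (mu : probability X R) : Prop :=
  forall A, measurable A -> (0 < mu A)%E ->
    exists B, [/\ measurable B, B `<=` A, (0 < mu B)%E & (mu B < mu A)%E].

Section automorphisms.
Context (R : realType) d (X : measurableType d) (mu : probability X R).

(* On a standard Borel space the inverse of a Borel bijection is Borel, so
   [mp_inv_measurable] is no restriction there. *)
Record mp_bij : Type := MpBij {
  mp_fun :> X -> X;
  mp_inv : X -> X;
  mp_funK : cancel mp_fun mp_inv;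
  mp_invK : cancel mp_inv mp_fun;
  mp_measurable : measurable_fun setT mp_fun;
  mp_inv_measurable : measurable_fun setT mp_inv;
  mp_preserving : forall A, measurable A -> mu (mp_fun @^-1` A) = mu A
}.

HB.instance Definition _ := gen_eqMixin mp_bij.
HB.instance Definition _ := gen_choiceMixin mp_bij.

Definition ae_equal (f g : mp_bij) : bool := `[< \forall x \ae mu, f x = g x >].

Lemma ae_equal_refl : reflexive ae_equal.
Proof. by move=> f; apply/asboolP; exact: aeW. Qed.

Lemma ae_equal_sym : symmetric ae_equal.
Proof.
by move=> f g; apply/asboolP/asboolP; apply: filterS => x ->.
Qed.

Lemma ae_equal_trans : transitive ae_equal.
Proof.
move=> g f h /asboolP fg /asboolP gh; apply/asboolP.
by apply: filterS2 fg gh => x -> ->.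
Qed.

Canonical ae_equal_equiv :=
  EquivRel ae_equal ae_equal_refl ae_equal_sym ae_equal_trans.

Definition mp_aut : Type := {eq_quot ae_equal}.
HB.instance Definition _ := Choice.on mp_aut.
HB.instance Definition _ := EqQuotient.on mp_aut.

(* The notions below are stated on a chosen representative, but do not depend on
   the choice. *)
Definition rep (U : mp_aut) : mp_bij := repr U.
Coercion rep : mp_aut >-> mp_bij.

Lemma aut_eqP (f g : mp_bij) :
  \pi_mp_aut f = \pi_mp_aut g <-> \forall x \ae mu, f x = g x.
Proof.
split=> [/eqmodP/asboolP //|fg]; apply/eqmodP; exact/asboolP.
Qed.

Lemma rep_pi (f : mp_bij) : \forall x \ae mu, rep (\pi_mp_aut f) x = f x.
Proof. by apply/aut_eqP; rewrite /rep reprK. Qed.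

Lemma repK (U : mp_aut) : \pi_mp_aut (rep U) = U.
Proof. exact: reprK. Qed.

Lemma mp_ae (f : mp_bij) (P : X -> Prop) :
  (\forall x \ae mu, P x) -> \forall x \ae mu, P (f x).
Proof.
move=> [N [mN N0 PN]]; exists (f @^-1` N); split.
- by rewrite -[_ @^-1` _]setTI; exact: mp_measurable.
- by rewrite mp_preserving.
- by move=> x /= Px; apply: PN.
Qed.

Lemma mp_id_preserving A : measurable A -> mu (id @^-1` A) = mu A.
Proof. by []. Qed.

Definition mp_one : mp_bij :=
  @MpBij id id (fun=> erefl) (fun=> erefl)
    (@measurable_id _ _ setT) (@measurable_id _ _ setT) mp_id_preserving.

Lemma mp_inv_preserving (f : mp_bij) A :
  measurable A -> mu (mp_inv f @^-1` A) = mu A.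
Proof.
move=> mA; rewrite -(mp_preserving f); last first.
  by rewrite -[_ @^-1` _]setTI; exact: mp_inv_measurable.
by congr (mu _); apply/seteqP; split=> x /=; rewrite mp_funK.
Qed.

Definition mp_opp (f : mp_bij) : mp_bij :=
  MpBij (@mp_invK f) (@mp_funK f) (mp_inv_measurable f) (mp_measurable f)
    (@mp_inv_preserving f).

Lemma mp_comp_preserving (f g : mp_bij) A :
  measurable A -> mu ((f \o g) @^-1` A) = mu A.
Proof.
move=> mA; rewrite comp_preimage mp_preserving ?mp_preserving//.
by rewrite -[_ @^-1` _]setTI; exact: mp_measurable.
Qed.

Definition mp_mul (f g : mp_bij) : mp_bij :=
  @MpBij (f \o g) (mp_inv g \o mp_inv f)
    (can_comp (@mp_funK f) (@mp_funK g)) (can_comp (@mp_invK g) (@mp_invK f))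
    (measurableT_comp (mp_measurable f) (mp_measurable g))
    (measurableT_comp (mp_inv_measurable g) (mp_inv_measurable f))
    (@mp_comp_preserving f g).

Definition aut_one : mp_aut := \pi_mp_aut mp_one.
Definition aut_mul (U V : mp_aut) : mp_aut := \pi_mp_aut (mp_mul U V).
Definition aut_inv (U : mp_aut) : mp_aut := \pi_mp_aut (mp_opp U).

Lemma aut_mulgA : associative aut_mul.
Proof.
move=> U V W; apply/aut_eqP.
have h1 := rep_pi (mp_mul V W).
have h2 := mp_ae W (rep_pi (mp_mul U V)).
by apply: filterS2 h1 h2 => x /= -> ->.
Qed.

Lemma aut_mul1g : left_id aut_one aut_mul.
Proof.
move=> U; rewrite -[RHS](repK U); apply/aut_eqP.
by apply: filterS (mp_ae U (rep_pi mp_one)) => x /= ->.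
Qed.

Lemma aut_mulg1 : right_id aut_one aut_mul.
Proof.
move=> U; rewrite -[RHS](repK U); apply/aut_eqP.
by apply: filterS (rep_pi mp_one) => x /= ->.
Qed.

Lemma aut_mulVg : left_inverse aut_one aut_inv aut_mul.
Proof.
move=> U; apply/aut_eqP.
apply: filterS (mp_ae U (rep_pi (mp_opp U))) => x /= ->.
by rewrite mp_funK.
Qed.

Lemma aut_mulgV : right_inverse aut_one aut_inv aut_mul.
Proof.
move=> U; apply/aut_eqP.
by apply: filterS (rep_pi (mp_opp U)) => x /= ->; rewrite mp_invK.
Qed.

HB.instance Definition _ := isGroup.Build mp_aut
  aut_mulgA aut_mul1g aut_mulg1 aut_mulVg aut_mulgV.

Definition iterz (f : mp_bij) (n : int) : X -> X :=
  match n with Posz k => iter k f | Negz k => iter k.+1 (mp_inv f) end.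

Definition mp_orbit (f : mp_bij) (x : X) : set X := range (iterz f ^~ x).

Definition ergodic (T : mp_aut) : Prop :=
  forall A, measurable A -> (forall x, A x -> mp_orbit T x `<=` A) ->
    mu A = 0%E \/ mu A = 1%E.

Definition is_periodic (U : mp_aut) : Prop :=
  \forall x \ae mu, finite_set (mp_orbit U x).

Definition full_group (T : mp_aut) : set mp_aut :=
  [set U | \forall x \ae mu, mp_orbit T x (U x)].

(* When [T] is aperiodic, the [c] such that [U x = T^(c x) x] almost everywhere
   is unique up to null sets: it is the cocycle of [U].  It can be taken
   measurable when [X] is standard Borel, so that integrability then only says
   that the integral of its absolute value is finite.  Quantifying over [c] makes
   the L1 full group a group for every [T]. *)
Definition integrable_cocycle (T U : mp_aut) (c : X -> int) : Prop :=
  (\forall x \ae mu, U x = iterz T (c x) x) /\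
  mu.-integrable setT (fun x => ((c x)%:~R : R)%:E).

Definition L1_full_group (T : mp_aut) : set mp_aut :=
  [set U | full_group T U /\ exists c, integrable_cocycle T U c].

Lemma iterz_succ f n x : iterz f (1 + n) x = f (iterz f n x).
Proof.
case: n => [k|[|k]] //; first by rewrite /= mp_invK.
have -> : 1 + Negz k.+1 = Negz k by rewrite !NegzE [in RHS]intS; lia.
by rewrite [iterz f (Negz k.+1) x]iterS mp_invK.
Qed.

Lemma iterz_pred f n x : iterz f (n - 1) x = mp_inv f (iterz f n x).
Proof.
by rewrite -[in RHS](subrK 1 n) [in RHS]addrC iterz_succ mp_funK.
Qed.

Lemma iterzD f m n x : iterz f (m + n) x = iterz f m (iterz f n x).
Proof.
elim/int_rec: m => [|m IH|m IH]; first by rewrite add0r.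
- by rewrite intS -addrA !iterz_succ IH.
- rewrite (_ : - m.+1%:Z = - m%:Z - 1); last by rewrite intS opprD addrC.
  by rewrite addrAC !iterz_pred IH.
Qed.

Lemma integrable_mp (f : mp_bij) (h : X -> \bar R) :
  mu.-integrable setT h -> mu.-integrable setT (h \o f).
Proof.
move=> /integrableP[mh ih]; apply/integrableP; split.
  exact: measurableT_comp mh (mp_measurable f).
suff -> : (\int[mu]_x `|(h \o f) x| = \int[mu]_x `|h x|)%E by [].
have := @ge0_integral_pushforward _ _ X X R f (mp_measurable f) mu setT
  (abse \o h) measurableT.
rewrite preimage_setT => <-//.
- apply: eq_measure_integral; first exact: mp_measurable.
  by move=> mf A mA _; exact: mp_preserving.
- exact: measurableT_comp.
- by move=> y _; exact: abse_ge0.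
Qed.

Lemma integrable_cocycle1 (T : mp_aut) : integrable_cocycle T 1%g (fun=> 0).
Proof.
split; first by apply: filterS (rep_pi mp_one) => x /= ->.
by apply: eq_integrable (integrable0 _ _) => // x.
Qed.

Lemma integrable_cocycleM (T U V : mp_aut) c e :
  integrable_cocycle T U c -> integrable_cocycle T V e ->
  integrable_cocycle T (U * V)%g (fun x => c (V x) + e x).
Proof.
move=> [Uc ic] [Ve ie]; split.
  have h1 := rep_pi (mp_mul U V).
  apply: filterS3 h1 (mp_ae V Uc) Ve => x /= -> -> Vx.
  by rewrite {2}Vx iterzD.
apply: eq_integrable (integrableD measurableT (integrable_mp V ic) ie).
- exact: measurableT.
- by move=> x _ /=; rewrite intrD EFinD.
Qed.

Lemma integrable_cocycleV (T U : mp_aut) c : integrable_cocycle T U c ->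
  integrable_cocycle T U^-1%g (fun x => - c (mp_inv U x)).
Proof.
move=> [Uc ic]; split.
  apply: filterS2 (rep_pi (mp_opp U)) (mp_ae (mp_opp U) Uc).
  move=> x /= ->; rewrite mp_invK => xE.
  transitivity (iterz T (- c (mp_inv U x) + c (mp_inv U x)) (mp_inv U x)).
    by rewrite addNr.
  by rewrite iterzD -xE.
have := integrableN (integrable_mp (mp_opp U) ic).
by apply: eq_integrable => [|x _]; [exact: measurableT|rewrite /= intrN].
Qed.

Lemma integrable_cocycle_full_group (T U : mp_aut) c :
  integrable_cocycle T U c -> full_group T U.
Proof. by case=> Uc _; apply: filterS Uc => x Ux; exists (c x). Qed.

Lemma L1_full_groupP (T U : mp_aut) :
  U \in L1_full_group T <-> exists c, integrable_cocycle T U c.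
Proof.
split=> [/set_mem[]//|[c Uc]]; apply/mem_set; split; last by exists c.
exact: integrable_cocycle_full_group Uc.
Qed.

Lemma L1_full_group_closed (T : mp_aut) :
  group_closed [in L1_full_group T].
Proof.
split; first by apply/L1_full_groupP; eexists; exact: integrable_cocycle1.
move=> U V /L1_full_groupP[c Uc] /L1_full_groupP[e Ve]; apply/L1_full_groupP.
eexists; exact: integrable_cocycleM Uc (integrable_cocycleV Ve).
Qed.

Definition L1 (T : mp_aut) : Type := {U : mp_aut | U \in L1_full_group T}.

HB.instance Definition _ (T : mp_aut) := SubChoice.on (L1 T).
HB.instance Definition _ (T : mp_aut) :=
  SubChoice_isSubGroup.Build mp_aut _ (L1 T) (L1_full_group_closed T).

Definition cocycle (T : mp_aut) (U : L1 T) : X -> int :=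
  xget (fun=> 0) (integrable_cocycle T (val U)).

Lemma cocycleP (T : mp_aut) (U : L1 T) :
  integrable_cocycle T (val U) (cocycle U).
Proof.
have /L1_full_groupP[c Uc] := valP U.
exact: (@xgetI _ _ _ c).
Qed.

Definition L1_dist (T : mp_aut) (U V : L1 T) : R :=
  \int[mu]_x `|(cocycle U x - cocycle V x)%:~R|.

Definition L1_index (T : mp_aut) (U : L1 T) : R := \int[mu]_x (cocycle U x)%:~R.

Lemma L1_dist_integrable (T : mp_aut) (U V : L1 T) :
  mu.-integrable setT (fun x => (`|(cocycle U x - cocycle V x)%:~R| : R)%:E).
Proof.
have [[_ iU] [_ iV]] := (cocycleP U, cocycleP V).
have := integrable_abse (integrableB measurableT iU iV).
by apply: eq_integrable => [|x _]; [exact: measurableT|rewrite /= intrB].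
Qed.

Lemma L1_distxx (T : mp_aut) (U : L1 T) : L1_dist U U = 0.
Proof.
rewrite /L1_dist (_ : (fun x => _) = cst 0) ?Rintegral_cst ?mul0r//.
by apply/funext => x /=; rewrite subrr normr0.
Qed.

Lemma L1_dist_sym (T : mp_aut) (U V : L1 T) : L1_dist U V = L1_dist V U.
Proof.
by apply: eq_Rintegral => x _; rewrite -normrN -intrN opprB.
Qed.

Lemma L1_dist_triangle (T : mp_aut) (V U W : L1 T) :
  L1_dist U W <= L1_dist U V + L1_dist V W.
Proof.
rewrite -RintegralD//; [|exact: L1_dist_integrable..].
apply: le_Rintegral => //; first exact: L1_dist_integrable.
- apply: eq_integrable (integrableD measurableT (L1_dist_integrable U V)
    (L1_dist_integrable V W)) => //.
- move=> x _; rewrite (le_trans _ (ler_normD _ _))// -intrD.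
  by rewrite addrA subrK.
Qed.

Lemma L1_dist_positivity (T : mp_aut) (U V : L1 T) : L1_dist U V = 0 -> U = V.
Proof.
move=> UV0; apply/val_inj; rewrite -[LHS]repK -[RHS]repK; apply/aut_eqP.
have [[cU iU] [cV iV]] := (cocycleP U, cocycleP V).
have iUV := L1_dist_integrable U V.
have := UV0; rewrite /L1_dist /Rintegral => /eqP.
rewrite fine_eq0; last exact: integrable_fin_num.
move=> /eqP int0.
have /(ae_eq_integral_abs mu measurableT)[+ _] := measurable_int _ iUV.
move=> /(_ _)/wrap[].
  by rewrite -int0; apply: eq_integral => x _ /=; rewrite normr_id.
move=> ae0; apply: filterS3 cU cV ae0 => x -> -> /(_ I)[].
by move/eqP; rewrite normr_eq0 intr_eq0 subr_eq0 => /eqP ->.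
Qed.

HB.instance Definition _ (T : mp_aut) :=
  isMetric.Build R (L1 T) (@L1_distxx T) (@L1_dist_positivity T)
    (@L1_dist_sym T) (@L1_dist_triangle T).

End automorphisms.

(* Main.v *)
Require Import Defs.
From mathcomp Require Import all_boot all_order all_algebra.
From mathcomp Require Import all_classical all_reals all_analysis.
From mathcomp Require Import measurable_realfun.
From mathcomp Require Import perm zify ring lra.

Set Implicit Arguments.
Unset Strict Implicit.
Unset Printing Implicit Defensive.

Import Order.TTheory GRing.Theory Num.Theory.
Import numFieldNormedType.Exports.

Local Open Scope classical_set_scope.
Local Open Scope ring_scope.

(** Write [c_U] for the cocycle of [U], so that the index of [U] is the mean of
    [c_U]. All the groups of the theorem are compared with the kernel of the
    index, through the simplest involutions: the swap of a set [C] with a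
    disjoint translate [T^n C], which acts as [T^n] on [C], as [T^-n] on [T^n C]
    and as the identity elsewhere.

    Three inclusions into the kernel are soft. The index is a continuous
    homomorphism to the reals, so its kernel is closed and contains the
    commutators. A periodic element has index 0 ([periodic_index]): on the set
    where a power of it is the identity, the cocycles along the orbits sum up to
    zero. Involutions, hence swaps, are periodic.

    The heart of the proof is the converse: every [U] of index 0 is [V P^-1], with
    [P] a finite product of swaps and [V] a periodic limit of such products.
    Identify an orbit with the integers and say that an orbit point jumps over
    [x] if [U] moves it from the past of [x] to its future or conversely. By the
    Borel-Cantelli lemma and the integrability of [c_U], only finitely many
    points jump over a given [x] ([cocycle_sublinear]), so that a set [A] of
    positive measure consists of points with the same jump pattern
    ([exists_jumps]); it can be chosen with gaps longer than the window where
    the jumps take place ([exists_spaced]). Composing [U] with a power of [T]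
    balances the numbers of forward and of backward jumps ([shift_balanced]).
    Then swapping forward jumpers with backward jumpers around each point of [A]
    yields an element [V] for which nobody jumps over a point of [A] anymore
    ([balanced_uncross]). So [V] preserves the intervals cut out of the orbits by
    [A], which are finite by ergodicity: [V] is periodic. It is also the limit
    of its restrictions to finitely many types of intervals, on each of which it
    is a permutation of the levels of a tower, that is, a product of swaps
    ([preserving_closure]).
    In particular the index of [U] is the exponent of the power of [T] that was
    used ([index_decomposition]): it is an integer, and for index 0 no power of
    [T] is needed.

    It remains to place the swaps. A swap is a limit of commutators, since its
    base can be exhausted by pairs of a set and a translate of it, and on such a
    pair it is a commutator of two swaps ([swap_in_closure_derived]). It is
    joined to the identity by a path, obtained by cutting its base along the
    level sets of an injective real function ([swap_component]). As the closed
    derived group and the component of the identity are closed subgroups, both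
    contain the kernel. Conversely a continuous function with integer values is
    constant on the component. *)

(** * Injecting a standard Borel space into the reals *)

Section standard_borel_spaces.
Context (R : realType) d (X : measurableType d).

(** Balls centred on a countable dense set separate points. Their interiors
    are taken because balls of a pseudometric space need not be open. *)
Lemma standard_borel_separating : standard_borel R X ->
  exists2 A : (set X)^nat, forall n, measurable (A n) &
    forall x y, (forall n, A n x <-> A n y) -> x = y.
Proof.
move=> [P [h [hP [D cD dD] [h' hK h'K] mX]]].
have /countable_injP[g ginj] := cD.
pose A (c : nat * nat) := h @^-1` \bigcup_(y in [set y | D y /\ g y = c.1])
  (ball y (c.2.+1%:R^-1 : R))^°.
pose B n := A (odflt (0, 0)%N (unpickle n)).
exists B.
  move=> n; rewrite /B; set c := odflt _ _; apply/mX.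
  exists (\bigcup_(y in [set y | D y /\ g y = c.1])
    (ball y (c.2.+1%:R^-1 : R))^°) => //.
  apply: sub_sigma_algebra; apply: bigcup_open => y _; exact: open_interior.
move=> x y xy; apply: (can_inj hK); apply: contrapT => /eqP hxy.
have [[ep rp]] : exists s : {posnum R} * {posnum R},
    ball (h x) s.1%:num `&` ball (h y) s.2%:num = set0.
  by move: hP; rewrite ball_hausdorff => /(_ _ _ hxy)[s /eqP sE]; exists s.
move=> /= dis; set e := ep%:num in dis.
have e0 : 0 < e by rewrite /e.
have {}dis : ~ ball (h x) e (h y).
  by move=> b; have : set0 (h y) by rewrite -dis; split=> //; apply: ballxx.
have e20 : 0 < e / 2 by rewrite divr_gt0.
pose k := Num.truncn (e / 2)^-1.
have ke : k.+1%:R^-1 <= e / 2.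
  rewrite -(invrK (e / 2)) lef_pV2 ?posrE ?invr_gt0 ?ltr0n//.
  by rewrite ltW// real_truncnS_gt ?num_real.
set dl : R := k.+1%:R^-1 in ke.
have dl0 : 0 < dl by rewrite invr_gt0.
have [z [zb zD]] : (ball (h x) (dl / 2))^° `&` D !=set0.
  apply: dD; last exact: open_interior.
  exists (h x); rewrite /interior; apply: nbhsx_ballx; by rewrite divr_gt0.
have {zb}/ball_sym zb := interior_subset zb.
have Ax : A (g z, k) x.
  exists z => //=; rewrite /interior /= nbhs_ballP.
  exists (dl / 2); first by rewrite /= divr_gt0.
  move=> w wb; rewrite -/dl [dl]splitr; exact: ball_triangle wb.
have : A (g z, k) y.
  have := xy (pickle (g z, k)); rewrite /B pickleK /= => -[+ _]; exact.
move=> [z' /= [z'D gz]].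
have -> : z' = z by apply: ginj => //; rewrite inE.
move=> /interior_subset; rewrite /= -/dl => zy; apply: dis.
apply: (@le_ball _ _ _ (dl / 2 + dl)); first lra.
exact: ball_triangle (ball_sym zb) zy.
Qed.

(** The indicators of a separating sequence are read as digits in base 4: with
    digits 0 and 1, the first difference outweighs all later ones. *)
Lemma standard_borel_injection : standard_borel R X ->
  exists phi : X -> R, [/\ measurable_fun setT phi, injective phi &
    forall x, 0 <= phi x <= 2].
Proof.
move=> /standard_borel_separating[A mA sepA].
pose b n x : R := \1_(A n) x.
pose s N x : R := \sum_(0 <= k < N) b k x / 4 ^+ k.
have b01 n x : 0 <= b n x <= 1.
  by rewrite /b indicE; case: (_ \in _) => /=; rewrite ?lexx ?ler01.
have p4 k : 0 < (4 : R) ^- k by rewrite invr_gt0 exprn_gt0.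
have gs n N : (n <= N)%N ->
    \sum_(n <= k < N) (4 : R) ^- k = 4 / 3 * (4 ^- n - 4 ^- N).
  elim: N => [|N IH]; first by rewrite leqn0 => /eqP ->; rewrite big_geq // subrr mulr0.
  rewrite leq_eqVlt => /orP[/eqP ->|]; first by rewrite big_geq // subrr mulr0.
  rewrite ltnS => nN; rewrite big_nat_recr //= IH // exprS invfM.
  by set u := (4 : R) ^- n; set v := (4 : R) ^- N; lra.
have sn x : nondecreasing_seq (s^~ x).
  apply/nondecreasing_seqP => n.
  rewrite /s big_nat_recr //= lerDl.
  by rewrite mulr_ge0.
have sb x N : s N x <= 2.
  apply: (@le_trans _ _ (\sum_(0 <= k < N) (4 : R) ^- k)).
    by apply: ler_sum => i _; rewrite ler_piMl //; case/andP: (b01 i x).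
  by rewrite gs // expr0 invr1; have := p4 N; lra.
have sc x : cvgn (s^~ x).
  by apply: nondecreasing_is_cvgn => //; exists 2 => _ [n _ <-].
have lim02 x : 0 <= limn (s^~ x) <= 2.
  apply/andP; split; last by apply: limr_le => //; exact: nearW.
  apply: limr_ge => //; apply: nearW => N; apply: sumr_ge0 => k _.
  by rewrite mulr_ge0 //; case/andP: (b01 k x).
exists (fun x => limn (s^~ x)); split=> //.
  apply: (@measurable_fun_cvg _ _ _ setT s) => //.
  move=> N; apply: measurable_sum => k; apply: measurable_funM => //.
  exact: measurable_indic.
have key n x y : (forall m, (m < n)%N -> b m x = b m y) -> A n x -> ~ A n y ->
    limn (s^~ y) < limn (s^~ x).
  move=> bxy Ax nAy.
  suff : limn (s^~ y) + 4 ^- n / 2 <= limn (s^~ x) by have := p4 n; lra.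
  have -> : limn (s^~ y) + 4 ^- n / 2 = limn (fun N => s N y + 4 ^- n / 2).
    by rewrite limD //; [rewrite lim_cst|exact: is_cvg_cst].
  apply: ler_lim => //; first by apply: is_cvgD => //; exact: is_cvg_cst.
  exists n.+1 => // N /= nN.
  have sE z : s N z = \sum_(0 <= k < n) b k z / 4 ^+ k + (b n z / 4 ^+ n
      + \sum_(n.+1 <= k < N) b k z / 4 ^+ k).
    rewrite /s (big_cat_nat (n := n)) //=; last by rewrite ltnW.
    by rewrite [X in _ + X]big_ltn.
  rewrite !sE -addrA.
  have -> : \sum_(0 <= k < n) b k x / 4 ^+ k = \sum_(0 <= k < n) b k y / 4 ^+ k.
    by apply: eq_big_nat => i /andP[_ /bxy ->].
  rewrite lerD2l.
  have -> : b n x = 1 by rewrite /b indicE mem_set.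
  have -> : b n y = 0 by rewrite /b indicE memNset.
  have h1 : \sum_(n.+1 <= k < N) b k y / 4 ^+ k <= 4 / 3 * (4 ^- n.+1 - 4 ^- N).
    by rewrite -gs //; apply: ler_sum => i _; rewrite ler_piMl //; case/andP: (b01 i y).
  have h2 : 0 <= \sum_(n.+1 <= k < N) b k x / 4 ^+ k.
    by apply: sumr_ge0 => i _; rewrite mulr_ge0.
  have : (4 : R) ^- n.+1 = 4^-1 * 4 ^- n by rewrite exprS invfM.
  by have := p4 N; have := p4 n; lra.
move=> x y xy; apply: sepA; apply: contrapT => /existsNP[n0 nn0].
have [n hn nmin] : exists2 n, ~ (A n x <-> A n y) &
    forall m, (m < n)%N -> (A m x <-> A m y).
  have ex : exists n, `[< ~ (A n x <-> A n y) >] by exists n0; apply/asboolP.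
  exists (ex_minn ex); first by case: ex_minnP => m /asboolP.
  case: ex_minnP => m _ mm k km; apply: contrapT => /asboolP/mm.
  by rewrite leqNgt km.
have bE m : (m < n)%N -> b m x = b m y.
  move=> /nmin [h1 h2]; rewrite /b !indicE; congr (_%:R); congr nat_of_bool.
  by apply/idP/idP; rewrite !inE.
have [Ax|nAx] := pselect (A n x); have [Ay|nAy] := pselect (A n y).
- by apply: hn; split.
- by have := key n x y bE Ax nAy; rewrite xy ltxx.
- by have := key n y x (fun m h => esym (bE m h)) Ay nAx; rewrite xy ltxx.
- by apply: hn; split.
Qed.

End standard_borel_spaces.

(** * Almost sure properties and sets of small measure *)

Section almost_everywhere.
Context (R : realType) d (X : measurableType d) (mu : probability X R).

Lemma countable_bigcup_measurable (I : countType) (D : set I) (F : I -> set X) :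
  (forall i, D i -> measurable (F i)) -> measurable (\bigcup_(i in D) F i).
Proof.
move=> mF; rewrite bigcup_mkcond; apply: countable_bigcupT_measurable => // i.
by case: ifPn => [/set_mem/mF|_]//.
Qed.

Lemma ae_all_count (I : countType) (P : I -> X -> Prop) :
  (forall i, \forall x \ae mu, P i x) -> \forall x \ae mu, forall i, P i x.
Proof.
move=> aeP; have /ae_foralln : forall n, \forall x \ae mu,
    if unpickle n is Some i then P i x else True.
  by move=> n; case: unpickle => [i|]; [exact: aeP|exact: aeW].
by apply: filterS => x + i => /(_ (pickle i)); rewrite pickleK.
Qed.

Lemma ae_notin_mu0 (A : set X) : measurable A ->
  (\forall x \ae mu, ~ A x) -> mu A = 0%E.
Proof.
move=> mA aeA; apply/negligibleP => //; move: aeA; apply: negligibleS.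
by move=> x Ax; exact.
Qed.

Lemma mu0_ae_notin (A : set X) : measurable A -> mu A = 0%E ->
  \forall x \ae mu, ~ A x.
Proof.
by move=> mA A0; exists A; split=> // x /= /contrapT.
Qed.

Lemma mu1_ae_in (A : set X) : measurable A -> mu A = 1%E ->
  \forall x \ae mu, A x.
Proof.
move=> mA A1; have mCA := measurableC mA.
have : mu (~` A) = 0%E by rewrite probability_setC // A1 subee.
by move/(mu0_ae_notin mCA); apply: filterS => x /contrapT.
Qed.

Lemma ae_False : ~ (\forall x \ae mu, False).
Proof.
move=> /(@filterS _ _ _ (fun=> False) (fun x => ~ setT x)) F.
have : mu setT = 0%E by apply: ae_notin_mu0 => //; exact: F.
by rewrite probability_setT => /eqP; rewrite onee_eq0.
Qed.

Lemma ae_exists_pos (I : countType) (A : I -> set X) :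
  (forall i, measurable (A i)) -> (\forall x \ae mu, exists i, A i x) ->
  exists i, (0 < mu (A i))%E.
Proof.
move=> mA aeA; apply: contrapT => /forallNP A0; apply: ae_False.
have : \forall x \ae mu, forall i, ~ A i x.
  apply: ae_all_count => i; apply: mu0_ae_notin => //.
  by apply/eqP; rewrite eq_le measure_ge0 andbT leNgt; exact/negP/A0.
by move: aeA; apply: filterS2 => x [i Ai] /(_ i).
Qed.

Lemma ae_exists_pos_in (I : countType) (B : set X) (A : I -> set X) :
  measurable B -> (0 < mu B)%E ->
  (forall i, measurable (A i)) -> (\forall x \ae mu, B x -> exists i, A i x) ->
  exists i, (0 < mu (B `&` A i))%E.
Proof.
move=> mB B0 mA aeA; apply: contrapT => /forallNP A0.
move: B0; rewrite ae_notin_mu0 ?ltxx //.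
have : \forall x \ae mu, forall i, ~ (B `&` A i) x.
  apply: ae_all_count => i; apply: mu0_ae_notin; first exact: measurableI.
  by apply/eqP; rewrite eq_le measure_ge0 andbT leNgt; exact/negP/A0.
by apply: filterS2 aeA => x BA nBA Bx; have [i Ai] := BA Bx; exact: (nBA i).
Qed.

Hypothesis mu_nonatomic : nonatomic mu.

(** Of a subset of smaller positive measure and its complement, one has at most
    half of the measure; this is iterated [k] times. *)
Lemma nonatomic_small_subset (A : set X) (k : nat) : measurable A ->
  (0 < mu A)%E ->
  exists B, [/\ measurable B, B `<=` A, (0 < mu B)%E &
    (mu B <= (2 ^- k)%:E)%E].
Proof.
move=> mA A0; elim: k => [|k [B [mB BA B0 Bk]]].
  by exists A; split=> //; rewrite expr0 invr1; exact: probability_le1.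
have [C [mC CB C0 CltB]] := mu_nonatomic mB B0.
have mBC : measurable (B `\` C) by exact: measurableD.
have BE : mu B = (mu C + mu (B `\` C))%E.
  rewrite -measureU //; first by rewrite setDUK.
  by apply/seteqP; split=> // x [Cx []].
have fE (D : set X) : measurable D -> exists2 r : R, mu D = r%:E & 0 <= r.
  move=> mD; exists (fine (mu D)); first by rewrite fineK // fin_num_measure.
  by rewrite fine_ge0.
have [c cE c0] := fE _ mC; have [e eE e0] := fE _ mBC.
have [b bE b0] := fE _ mB.
rewrite cE eE bE -EFinD in BE; case: BE => BE.
have kE : (2 : R) ^- k.+1 = 2^-1 * 2 ^- k by rewrite exprS invfM.
move: Bk C0 CltB; rewrite bE cE !lte_fin lee_fin => Bk cp cb.
have [ce|ec] := leP c e.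
  exists C; split=> //; [exact: subset_trans BA|by rewrite cE lte_fin|].
  by rewrite cE lee_fin kE; lra.
exists (B `\` C); split=> //; first by apply: subset_trans BA => x [].
- by rewrite eE lte_fin; lra.
- by rewrite eE lee_fin kE; lra.
Qed.

Context (phi : X -> R) (mphi : measurable_fun setT phi) (phi_inj : injective phi).

Lemma measurable_phi_pre (B : set R) : measurable B -> measurable (phi @^-1` B).
Proof. by move=> mB; rewrite -[_ @^-1` _]setTI; exact: mphi. Qed.

(** A set with at most one point has no subset of strictly smaller positive
    measure. *)
Lemma fiber_mu0 t : mu (phi @^-1` [set t]) = 0%E.
Proof.
have mF : measurable (phi @^-1` [set t]) by exact: measurable_phi_pre.
apply/eqP; rewrite eq_le measure_ge0 andbT leNgt; apply/negP => F0.
have [B [mB BF B0 BltF]] := mu_nonatomic mF F0.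
have [B00|/set0P[x Bx]] := eqVneq B set0; first by rewrite B00 measure0 ltxx in B0.
move: BltF; rewrite (_ : B = phi @^-1` [set t]) ?ltxx //.
apply/seteqP; split=> // y yt; suff -> : y = x by [].
by apply: phi_inj; rewrite yt (BF x Bx).
Qed.

(** Continuity from above, as the fibre over [t] is null. The function
    [t |-> mu (phi <= t)] is thus continuous, which is where the paths in the
    full group come from. *)
Lemma fiber_nbhd_small t (e : R) : 0 < e ->
  exists2 r, 0 < r & (mu (phi @^-1` `[(t - r)%R, (t + r)%R]%classic) < e%:E)%E.
Proof.
move=> e0; pose F n := phi @^-1` `[t - n.+1%:R^-1, t + n.+1%:R^-1]%classic.
have mF n : measurable (F n) by exact: measurable_phi_pre.
have capF : \bigcap_n F n = phi @^-1` [set t].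
  apply/seteqP; split=> [x Fx|x /= xt n _]; last first.
    by rewrite /F /= in_itv /= xt lerDl gerBl andbb invr_ge0.
  apply/eqP/negP => /negP xt; have : 0 < `|phi x - t| by rewrite normr_gt0 subr_eq0.
  set r := `|_| => r0; have := Fx (Num.truncn r^-1) I.
  rewrite /F /= in_itv /= => xI.
  have : r <= (Num.truncn r^-1).+1%:R^-1.
    by rewrite ler_norml; set s := _^-1 in xI *; move: xI => /andP[]; lra.
  apply/negP; rewrite -ltNge invf_plt ?posrE ?ltr0n //.
  by rewrite real_truncnS_gt ?num_real.
have : mu (F n) @[n --> \oo] --> mu (\bigcap_n F n).
  apply: nonincreasing_cvg_mu => //.
  - by rewrite (le_lt_trans (probability_le1 _ _)) ?ltry.
  - exact: bigcapT_measurable.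
  - move=> m n mn; apply/subsetPset => x; rewrite /F /= !in_itv /=.
    have : n.+1%:R^-1 <= m.+1%:R^-1 :> R by rewrite lef_pV2 ?posrE ?ltr0n // ler_nat.
    by set u := n.+1%:R^-1; set v := _^-1 => uv /andP[xa xb]; apply/andP; split; lra.
rewrite capF fiber_mu0 => /fine_cvgP[_].
move/cvgrPdist_lt => /(_ _ e0)[N _ /(_ N)]; rewrite /= leqnn => /(_ isT).
rewrite sub0r normrN ger0_norm ?fine_ge0 // => FN.
exists N.+1%:R^-1; first by rewrite invr_gt0.
by rewrite -(fineK (fin_num_measure mu _ (mF N))) lte_fin.
Qed.

End almost_everywhere.

(** * Orbits of a measure-preserving bijection *)

Section powers.
Context (R : realType) d (X : measurableType d) (mu : probability X R).
Implicit Types (f : mp_bij mu) (A B W : set X).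

Lemma iterzK f n : cancel (iterz f n) (iterz f (- n)).
Proof. by move=> x; rewrite -iterzD addNr. Qed.

Lemma iterzNK f n : cancel (iterz f (- n)) (iterz f n).
Proof. by move=> x; rewrite -iterzD addrN. Qed.

Lemma measurable_iterz f n : measurable_fun setT (iterz f n).
Proof.
elim/int_rec: n => [|n IH|n IH]; first exact: measurable_id.
- have -> : iterz f n.+1 = f \o iterz f n.
    by apply/funext => x; rewrite intS iterz_succ.
  exact: measurableT_comp (mp_measurable f) IH.
- have -> : iterz f (- n.+1%:Z) = mp_inv f \o iterz f (- n%:Z).
    by apply/funext => x; rewrite /comp -iterz_pred; congr iterz; lia.
  exact: measurableT_comp (mp_inv_measurable f) IH.
Qed.

Lemma iterz_preserving f n A : measurable A -> mu (iterz f n @^-1` A) = mu A.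
Proof.
elim/int_rec: n A => [//|n IH|n IH] A mA.
- have -> : iterz f n.+1 = iterz f n \o f.
    by apply/funext => x; rewrite intS addrC iterzD.
  rewrite comp_preimage mp_preserving ?IH //.
  by rewrite -[_ @^-1` _]setTI; exact: measurable_iterz.
- have -> : iterz f (- n.+1%:Z) = iterz f (- n%:Z) \o mp_inv f.
    apply/funext => x; rewrite (_ : - n.+1%:Z = - n%:Z + (- 1)%R) ?iterzD //.
    by lia.
  rewrite comp_preimage mp_inv_preserving ?IH //.
  by rewrite -[_ @^-1` _]setTI; exact: measurable_iterz.
Qed.

Definition mp_pow f n : mp_bij mu :=
  MpBij (@iterzK f n) (@iterzNK f n) (measurable_iterz f n)
    (measurable_iterz f (- n)) (@iterz_preserving f n).

Lemma measurable_iterz_pre f n A : measurable A -> measurable (iterz f n @^-1` A).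
Proof. by move=> mA; rewrite -[_ @^-1` _]setTI; exact: measurable_iterz. Qed.

Lemma ae_orbit f (P : X -> Prop) : (\forall x \ae mu, P x) ->
  \forall x \ae mu, forall n, P (iterz f n x).
Proof. by move=> aeP; apply: ae_all_count => n; exact: (mp_ae (mp_pow f n) aeP). Qed.

Definition free_at f x := forall n, n != 0 -> iterz f n x <> x.

Lemma free_iterz_inj f x m n : free_at f x -> iterz f m x = iterz f n x -> m = n.
Proof.
move=> fx /(congr1 (iterz f (- n))); rewrite iterzK -iterzD => E.
apply/eqP; rewrite -subr_eq0 addrC; apply/negP => /negP /fx; exact.
Qed.

(** Off a null set the translates of [W] are disjoint, and a probability space
    has no room for infinitely many disjoint sets of the same positive
    measure. *)
Lemma wandering_mu0 f W : measurable W ->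
  (forall l : nat, \forall x \ae mu, W x -> ~ W (iterz f l.+1 x)) -> mu W = 0%E.
Proof.
move=> mW wW.
pose N := \bigcup_(l : nat) (W `&` iterz f l.+1 @^-1` W).
have mN : measurable N.
  by apply: bigcupT_measurable => l; apply: measurableI => //;
    exact: measurable_iterz_pre.
have N0 : mu N = 0%E.
  apply: ae_notin_mu0 => //; apply: filterS (ae_all_count wW) => x Wx [l _ [Wlx]].
  exact: Wx.
pose V := W `\` N.
have mV : measurable V by exact: measurableD.
have V0 : mu V = 0%E.
  pose F n := iterz f (Posz n) @^-1` V.
  have mF n : measurable (F n) by exact: measurable_iterz_pre.
  have dF m n x : (m < n)%N -> F m x -> ~ F n x.
    move=> mn [Wm Nm] [Wn _]; apply: Nm; exists (n - m.+1)%N => //; split=> //=.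
    move: Wn; rewrite (_ : Posz n = (n - m.+1).+1%:Z + m%:Z) ?iterzD //; lia.
  have tF : trivIset setT F.
    apply/trivIsetP => m n _ _; rewrite neq_ltn => /orP[] mn;
    apply/seteqP; split=> // x [Fm Fn]; first exact: dF mn Fm Fn.
    exact: dF mn Fn Fm.
  have := measure_semi_bigcup mu mF tF (bigcupT_measurable F mF).
  have FE n : mu (F n) = mu V by exact: iterz_preserving.
  move=> E; have VE : mu V = (fine (mu V))%:E by rewrite fineK // fin_num_measure.
  have v0 : 0 <= fine (mu V) by rewrite fine_ge0.
  have bnd k : k%:R * fine (mu V) <= 1.
    rewrite -lee_fin.
    apply: (@le_trans _ _ (mu (\bigcup_n F n))); last first.
      by apply: probability_le1; exact: bigcupT_measurable.
    rewrite E; apply: le_trans (nneseries_lim_ge (m := 0) k _) => //.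
    rewrite (eq_bigr (fun=> (fine (mu V))%:E)); last first.
      by move=> i _; rewrite -VE; exact: FE.
    by rewrite sumEFin big_const_nat subn0 iter_addr_0 mulr_natl.
  rewrite VE; congr (_%:E); apply/eqP; rewrite eq_le v0 andbT leNgt; apply/negP => vp.
  have := bnd (Num.truncn (fine (mu V))^-1).+1; apply/negP; rewrite -ltNge.
  by rewrite -ltr_pdivrMr // mul1r real_truncnS_gt ?num_real.
apply/eqP; rewrite eq_le measure_ge0 andbT.
apply: (@le_trans _ _ (mu (V `|` N))).
  apply: le_measure; rewrite ?inE //; first exact: measurableU.
  by move=> x Wx; have [Nx|Nx] := pselect (N x); [right|left].
rewrite (le_trans (measureU2 mu mV mN)) //.
by rewrite [X in (X + _)%E]V0 [X in (_ + X)%E]N0 adde0.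
Qed.

Section aperiodicity.
Variable f : mp_bij mu.
Hypothesis f_ergodic : forall A, measurable A ->
  (forall x, A x -> mp_orbit f x `<=` A) -> mu A = 0%E \/ mu A = 1%E.

(** The points of [A] that never come back to [A] form a wandering set, and so
    do those that never were in [A] before. *)
Lemma ergodic_recurrent A : measurable A -> (0 < mu A)%E ->
  \forall x \ae mu, (exists n : nat, A (iterz f n x)) /\
    (exists n : nat, A (iterz f (- n%:Z) x)).
Proof.
move=> mA A0.
have mpre n : measurable (iterz f n @^-1` A) by exact: measurable_iterz_pre.
pose S := \bigcup_(k : nat) (iterz f k%:Z @^-1` A `|` iterz f (- k%:Z) @^-1` A).
have mS : measurable S by apply: bigcupT_measurable => n; exact: measurableU.
have SE x : S x <-> exists n, A (iterz f n x).
  split=> [[n _ [Ax|Ax]]|[[n|n] Ax]]; [by eexists; exact: Ax..| |].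
    by exists n => //; left.
  by exists n.+1 => //; right.
have S1 : mu S = 1%E.
  have [//|S0|//] := f_ergodic mS.
    move=> x /SE[n An] _ [m _ <-]; apply/SE; exists (n - m).
    by rewrite -iterzD subrK.
  exfalso; move: A0; rewrite lt_neqAle eq_sym => /andP[/negP nA _]; apply: nA.
  rewrite -measure_le0 -S0; apply: le_measure; rewrite ?inE //.
  by move=> x Ax; apply/SE; exists 0.
(* [s] being positive or negative, the last or the first visits to [A] *)
pose W (s : nat -> int) := A `\` \bigcup_(l : nat) (iterz f (s l) @^-1` A).
have mW s : measurable (W s).
  by apply: measurableD => //; exact: bigcupT_measurable.
have Wp0 : mu (W (fun l => l.+1%:Z)) = 0%E.
  apply: (@wandering_mu0 f) => // l; apply: aeW => x [_ Wx] [Ax _].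
  by apply: Wx; exists l.
have Wn0 : mu (W (fun l => - l.+1%:Z)) = 0%E.
  apply: (@wandering_mu0 f) => // l; apply: aeW => x [Ax _] [_ Wx].
  apply: Wx; exists l => //.
  by rewrite /preimage/mkset iterzK.
have stepP (s : int -> int) (W' : set X) x :
    (forall n, ~ W' (iterz f n x)) -> S x ->
    (forall n, A (iterz f n x) -> ~ W' (iterz f n x) ->
       exists2 m, s m >= s n + 1 & A (iterz f m x)) ->
    exists2 m, s m >= 0 & A (iterz f m x).
  move=> nW /SE[n0 An0] st.
  have : forall k : nat, exists2 m, s m >= s n0 + k%:Z & A (iterz f m x).
    elim=> [|k [m sm Am]]; first by exists n0 => //; rewrite addr0.
    by have [m' sm' Am'] := st m Am (nW m); exists m' => //; lia.
  by move=> /(_ `|s n0|%N) [m sm Am]; exists m => //; lia.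
have := ae_orbit f (mu0_ae_notin (mW _) Wp0).
have := ae_orbit f (mu0_ae_notin (mW _) Wn0).
apply: filterS3 (mu1_ae_in mS S1) => x Sx nWn nWp; split.
- have [|m m0 Am] := stepP id _ x nWp Sx.
    move=> n An /not_andP[//|/contrapT[l _ /= Al]].
    by exists (l.+1%:Z + n); [lia|rewrite iterzD].
  by case: m m0 Am => // m _ Am; exists m.
- have [|m m0 Am] := stepP -%R _ x nWn Sx.
    move=> n An /not_andP[//|/contrapT[l _ /= Al]].
    by exists (- l.+1%:Z + n); [lia|rewrite iterzD].
  exists `|m|%N; rewrite (_ : - _ = m) //; lia.
Qed.

Hypothesis mu_nonatomic : nonatomic mu.
Context (phi : X -> R) (mphi : measurable_fun setT phi) (phi_inj : injective phi).

(** Where [f^(n+1)] is the identity, a set of measure less than [1/(n+1)] has an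
    orbit consisting of [n+1] translates: an invariant set of measure strictly
    between 0 and 1. *)
Lemma ergodic_free : \forall x \ae mu, free_at f x.
Proof.
suff H : forall n : nat, \forall x \ae mu, iterz f n.+1 x <> x.
  apply: filterS (ae_all_count H) => x Hx [[//|n]|n] _; first exact: Hx.
  move=> /(congr1 (iterz f n.+1)); rewrite NegzE iterzNK => /esym.
  exact: Hx.
move=> n; pose Q := [set x | phi (iterz f n.+1 x) = phi x].
have mphin : measurable_fun setT (phi \o iterz f n.+1).
  exact: measurableT_comp mphi (measurable_iterz _ _).
have mQ : measurable Q.
  have := measurable_fun_eqr mphin mphi measurableT (Y := [set true]) I.
  rewrite setTI (_ : _ @^-1` _ = Q) //.
  by apply/seteqP; split=> x /= /eqP.
suff Q0 : mu Q = 0%E.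
  by apply: filterS (mu0_ae_notin mQ Q0) => x nQ E; apply: nQ; rewrite /Q/mkset E.
have QE x : Q x <-> iterz f n.+1 x = x.
  by rewrite /Q/mkset; split=> [/phi_inj|->].
have Qinv m x : Q x -> Q (iterz f m x).
  move=> /QE Qx; apply/QE.
  by rewrite -iterzD addrC iterzD Qx.
have [//|//|Q1] := f_ergodic mQ; first by move=> x Qx _ [m _ <-]; exact: Qinv.
exfalso.
have Qp : (0 < mu Q)%E by rewrite Q1 lte01.
have [B [mB BQ B0 Bs]] := nonatomic_small_subset mu_nonatomic n.+1 mQ Qp.
pose F (i : nat) := iterz f i @^-1` B.
have mF (i : nat) : measurable (F i) by exact: measurable_iterz_pre.
pose S := Q `&` \big[setU/set0]_(i < n.+1) F i.
have mS : measurable S by apply: measurableI => //; exact: bigsetU_measurable.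
have SE x : S x <-> Q x /\ exists m, B (iterz f m x).
  rewrite /S -bigcup_mkord; split=> [[Qx [i _ Bi]]|[Qx [m Bm]]].
    by split=> //; exists i.
  split=> //.
  have Qk k : iterz f (k * n.+1%:Z) x = x.
    have /QE E := Qx; elim/int_rec: k => [|k IH|k IH]; first by rewrite mul0r.
    - by rewrite intS mulrDl mul1r addrC iterzD E.
    - rewrite -[RHS]IH -[in LHS]E -iterzD; congr iterz; lia.
  have := divz_eq m n.+1; set q := (m %/ _)%Z; set r := (m %% _)%Z => mE.
  have r0 : 0 <= r by rewrite modz_ge0.
  have rn : r < n.+1%:Z by rewrite ltz_pmod.
  have rl : (`|r|%N < n.+1)%N by lia.
  exists `|r|%N => //; rewrite /F/preimage/mkset (_ : Posz `|r|%N = r); last lia.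
  by move: Bm; rewrite mE addrC iterzD Qk.
have S1 : (mu S < 1)%E.
  apply: (@le_lt_trans _ _ (mu (\big[setU/set0]_(i < n.+1) F i))).
    apply: le_measure; rewrite ?inE //; first exact: bigsetU_measurable.
    by move=> x [].
  apply: le_lt_trans (Boole_inequality mu (fun i _ => mF i)) _.
  apply: (@le_lt_trans _ _ (\sum_(i < n.+1) (2 ^- n.+1 : R)%:E)%E).
    by apply: lee_sum => i _; rewrite [leLHS]iterz_preserving.
  rewrite sumEFin lte_fin sumr_const card_ord -[_ *+ _]mulr_natl.
  rewrite ltr_pdivrMr ?exprn_gt0 // mul1r -natrX ltr_nat.
  exact: ltn_expl.
have S0 : (0 < mu S)%E.
  apply: (lt_le_trans B0); apply: le_measure; rewrite ?inE //.
  by move=> x Bx; apply/SE; split; [exact: BQ|exists 0].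
have [|SS|SS] := f_ergodic mS; [|by rewrite SS ltxx in S0|by rewrite SS ltxx in S1].
move=> x /SE[Qx [m Bm]] _ [k _ <-]; apply/SE; split; first exact: Qinv.
by exists (m - k); rewrite -iterzD subrK.
Qed.
End aperiodicity.

End powers.

(** * Integrals of real functions *)

Section real_integrals.
Context (R : realType) d (X : measurableType d) (mu : probability X R).
Implicit Types (g h : X -> R) (D : set X).
Local Notation integ h := (mu.-integrable setT (EFin \o h)).

Lemma integ_meas h : integ h -> measurable_fun setT h.
Proof. by move=> ih; apply/measurable_EFinP; exact: measurable_int ih. Qed.

Lemma integD g h : integ g -> integ h -> integ (fun x => g x + h x).
Proof.
move=> ig ih; apply: eq_integrable (integrableD measurableT ig ih) => //.
Qed.

Lemma integB g h : integ g -> integ h -> integ (fun x => g x - h x).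
Proof.
move=> ig ih; apply: eq_integrable (integrableB measurableT ig ih) => //.
Qed.

Lemma ae_eq_Rintegral g h : integ g -> integ h ->
  (\forall x \ae mu, g x = h x) -> \int[mu]_x g x = \int[mu]_x h x.
Proof.
move=> ig ih gh; rewrite /Rintegral; congr fine; apply: ae_eq_integral => //.
- exact: measurable_int ig.
- exact: measurable_int ih.
- by apply: filterS gh => x /= -> _.
Qed.

Lemma ae_le_Rintegral g h : integ g -> integ h ->
  (\forall x \ae mu, g x <= h x) -> \int[mu]_x g x <= \int[mu]_x h x.
Proof.
move=> ig ih gh; rewrite -subr_ge0 -RintegralB //.
rewrite (@ae_eq_Rintegral _ (fun x => `|h x - g x|)); first exact: Rintegral_ge0.
- exact: integB.
- by apply: integrable_norm; exact: integB.
- by apply: filterS gh => x gh; rewrite ger0_norm // subr_ge0.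
Qed.

Lemma le_integ g h : measurable_fun setT g -> integ h ->
  (forall x, `|g x| <= `|h x|) -> integ g.
Proof.
move=> mg ih gh; apply: le_integrable ih => //; first exact/measurable_EFinP.
by move=> x _; rewrite /= lee_fin.
Qed.

Lemma Rintegral_mp (f : mp_bij mu) h : integ h ->
  \int[mu]_x h (f x) = \int[mu]_x h x.
Proof.
move=> ih; rewrite /Rintegral; congr fine.
have := @integral_pushforward _ _ X X R f (mp_measurable f) mu setT (EFin \o h).
rewrite preimage_setT => /(_ _ _ measurableT) <-.
- apply: eq_measure_integral; first exact: mp_measurable.
  move=> mf A mA _; exact: mp_preserving.
- exact: measurable_int ih.
- exact: integrable_mp.
Qed.

Lemma integ_mp (f : mp_bij mu) h : integ h -> integ (fun x => h (f x)).
Proof. exact: integrable_mp. Qed.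

Lemma integ_indic h D : measurable D -> integ h -> integ (fun x => h x * \1_D x).
Proof.
move=> mD ih; apply: (le_integ _ ih) => [|x].
  by apply: measurable_funM; [exact: integ_meas|exact: measurable_indic].
rewrite normrM ler_piMr // indicE; case: (_ \in _) => /=.
  by rewrite normr1.
by rewrite normr0.
Qed.

Lemma Rintegral_indic D : measurable D -> \int[mu]_x \1_D x = fine (mu D).
Proof. by move=> mD; rewrite /Rintegral integral_indic // setIT. Qed.

(** Dominated convergence for functions that vanish pointwise from some rank
    on: those attached to sets exhausting the space. *)
Lemma eventually0_Rintegral (h : nat -> X -> R) g :
  (forall n, measurable_fun setT (h n)) -> integ g ->
  (\forall x \ae mu, forall n, `|h n x| <= g x) ->
  (\forall x \ae mu, exists N, forall n, (N <= n)%N -> h n x = 0) ->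
  forall e, 0 < e -> exists n, `|\int[mu]_x h n x| < e.
Proof.
move=> mh ig hg h0 e e0.
have := @dominated_convergence _ X R mu setT measurableT (fun n => EFin \o h n)
  (cst 0%E) (EFin \o g).
case=> //.
- by move=> n; exact/measurable_EFinP.
- apply: filterS h0 => x [N hN] _; apply: cvg_near_cst.
  by exists N => // n /= /hN ->.
- by apply: filterS hg => x hg n _; rewrite /= lee_fin.
move=> _ _; rewrite integral_cst // mul0e => /fine_cvgP[_].
move/cvgrPdist_lt => /(_ _ e0)[N _ /(_ N)]; rewrite /= leqnn => /(_ isT).
by rewrite sub0r normrN => hN; exists N.
Qed.

(** The contribution of the values above [n] is small in mean for large [n], by
    dominated convergence, and the remaining values are bounded by [n]. *)
Lemma abs_continuity h : integ h -> forall e, 0 < e ->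
  exists2 dl, 0 < dl & forall D, measurable D -> (mu D < dl%:E)%E ->
    \int[mu]_x (`|h x| * \1_D x) < e.
Proof.
move=> ih e e0; have mh := integ_meas ih.
have e20 : 0 < e / 2 by rewrite divr_gt0.
pose F n := [set x | n%:R <= `|h x|].
have mF n : measurable (F n).
  have mnorm := measurableT_comp (@normr_measurable R setT) mh.
  have := measurable_fun_ler (measurable_cst (n%:R : R)) mnorm measurableT
    (Y := [set true]) I.
  by rewrite setTI (_ : _ @^-1` _ = F n).
have inorm : integ (fun x => `|h x|) by exact: integrable_norm.
have [||n] := @eventually0_Rintegral (fun n x => `|h x| * \1_(F n) x) (fun x => `|h x|)
  (fun n => integ_meas (integ_indic (mF n) inorm)) inorm _ _ _ e20.
- apply: aeW => x n; rewrite indicE; case: (_ \in _) => /=.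
    by rewrite mulr1 normr_id.
  by rewrite mulr0 normr0.
- apply: aeW => x; exists (Num.truncn `|h x|).+1 => n hn.
  rewrite indicE memNset ?mulr0 // /F /=; apply/negP; rewrite -ltNge.
  apply: lt_le_trans (real_truncnS_gt (num_real _)) _.
  by rewrite ler_nat.
rewrite ger0_norm; last by apply: Rintegral_ge0 => x _; rewrite mulr_ge0 // indicE.
move=> hn; exists (e / 2 / n.+1%:R); first by rewrite divr_gt0.
move=> D mD muD.
have i1 : integ (fun x => n.+1%:R * \1_D x).
  apply: (integ_indic mD (h := cst n.+1%:R)).
  exact: finite_measure_integrable_cst.
apply: (@le_lt_trans _ _ (\int[mu]_x (n.+1%:R * \1_D x + `|h x| * \1_(F n) x))).
  apply: ae_le_Rintegral.
  - exact: integ_indic.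
  - by apply: integD => //; exact: integ_indic.
  - apply: aeW => x; rewrite !indicE; have [xF|xF] := boolP (x \in F n).
      rewrite /= mulr1; apply: (@le_trans _ _ `|h x|); last by rewrite lerDr mulr_ge0.
      by rewrite ler_piMr //; case: (_ \in _).
    rewrite /= mulr0 addr0; apply: ler_wpM2r => //.
    move: xF; rewrite notin_setE /F /= => /negP; rewrite -ltNge => /ltW/le_trans; apply.
    by rewrite ler_nat.
rewrite RintegralD //; last exact: integ_indic.
rewrite RintegralZl //; last exact: integrable_indic.
rewrite Rintegral_indic // [e]splitr ltrD //.
move: muD; rewrite -(fineK (fin_num_measure mu _ mD)) lte_fin.
by rewrite ltr_pdivlMr // mulrC.
Qed.

End real_integrals.

(** * Subgroups *)

Section subgroups.
Variable G : groupType.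
Implicit Types (H K : set G) (U V : G).

Lemma subgroup1 H : subgroup H -> H 1%g.
Proof. by case=> /set_mem. Qed.

Lemma subgroup_div H U V : subgroup H -> H U -> H V -> H (U * V^-1)%g.
Proof.
by move=> [_ HD] HU HV; apply/set_mem; apply: HD; exact/mem_set.
Qed.

Lemma subgroupP H : H 1%g -> (forall U V, H U -> H V -> H (U * V^-1)%g) ->
  subgroup H.
Proof.
move=> H1 HD; split; first exact/mem_set.
by move=> U V /set_mem HU /set_mem HV; apply/mem_set; exact: HD.
Qed.

Lemma subgroupV H U : subgroup H -> H U -> H U^-1%g.
Proof.
by move=> sH HU; rewrite -[_^-1%g]mul1g; apply: subgroup_div => //; exact: subgroup1.
Qed.

Lemma subgroupM H U V : subgroup H -> H U -> H V -> H (U * V)%g.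
Proof.
move=> sH HU HV; rewrite -[V]invgK; apply: subgroup_div => //.
exact: subgroupV.
Qed.

Lemma generated_subgroupP H : subgroup (generated_subgroup H).
Proof.
apply: subgroupP => [K [sK _]|U V HU HV K [sK HK]]; first exact: subgroup1.
by apply: subgroup_div => //; [exact: HU|exact: HV].
Qed.

Lemma subset_generated_subgroup H : H `<=` generated_subgroup H.
Proof. by move=> U HU K [_ HK]; exact: HK. Qed.

Lemma generated_subgroup_sub H K : subgroup K -> H `<=` K ->
  generated_subgroup H `<=` K.
Proof. by move=> sK HK U; exact. Qed.

End subgroups.

(** * Cocycles and the distance *)

Section cocycles.
Context (R : realType) d (X : measurableType d) (mu : probability X R).
Context (T : mp_aut mu).
Hypothesis T_free : \forall x \ae mu, free_at T x.
Implicit Types (U V W : L1 T).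
Local Notation integ h := (mu.-integrable setT (EFin \o h)).
Local Notation it := (iterz (rep T)).
Local Notation act U := (mp_fun (rep (val U))).

Lemma cocycle_act U : \forall x \ae mu, act U x = it (cocycle U x) x.
Proof. by have [] := cocycleP U. Qed.

Lemma cocycle_integ U : integ (fun x => (cocycle U x)%:~R).
Proof. by have [_] := cocycleP U. Qed.

Lemma cocycle_uniq U (c : X -> int) :
  (\forall x \ae mu, act U x = it (c x) x) -> \forall x \ae mu, cocycle U x = c x.
Proof.
move=> Uc; apply: filterS3 T_free Uc (cocycle_act U) => x fx -> E.
exact/esym/(free_iterz_inj fx E).
Qed.

Lemma act_eq_cocycle U V : (\forall x \ae mu, cocycle U x = cocycle V x) -> U = V.
Proof.
move=> UV; apply/val_inj; rewrite -[LHS]repK -[RHS]repK; apply/aut_eqP.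
by apply: filterS3 UV (cocycle_act U) (cocycle_act V) => x E -> ->; rewrite E.
Qed.

Lemma measurable_cocycle U (P : int -> Prop) : measurable [set x | P (cocycle U x)].
Proof.
have := integ_meas (cocycle_integ U) measurableT (measurable_set1 (_ : R)) => mU.
have -> : [set x | P (cocycle U x)] = \bigcup_(n in [set n : int | P n])
    [set x | cocycle U x = n].
  by apply/seteqP; split=> [x Px|x [n Pn /= ->]] //; exists (cocycle U x).
apply: countable_bigcup_measurable => n _; have := mU n%:~R.
rewrite setTI (_ : _ @^-1` _ = [set x | cocycle U x = n]) //.
by apply/seteqP; split=> x /= => [/intr_inj|->].
Qed.

Lemma measurable_neq_cocycle U V :
  measurable [set x | cocycle U x != cocycle V x].
Proof.
have -> : [set x | cocycle U x != cocycle V x] = \bigcup_(n in [set: int])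
    ([set x | cocycle U x = n] `&` [set x | cocycle V x != n]).
  apply/seteqP; split=> [x Dx|x [n _ [/= ->]]]; last by rewrite eq_sym.
  by exists (cocycle U x) => //; split => //=; rewrite eq_sym.
apply: countable_bigcup_measurable => n _.
apply: measurableI; first exact: (measurable_cocycle U (fun m => m = n)).
exact: (measurable_cocycle V (fun m => m != n)).
Qed.

Lemma cocycleM U V : \forall x \ae mu,
  cocycle (U * V)%g x = cocycle U (act V x) + cocycle V x.
Proof.
apply: cocycle_uniq.
by have [] := integrable_cocycleM (cocycleP U) (cocycleP V).
Qed.

Lemma cocycle1 : \forall x \ae mu, cocycle (1%g : L1 T) x = 0.
Proof. by apply: cocycle_uniq; have [] := integrable_cocycle1 T. Qed.

Lemma actM U V : \forall x \ae mu, act (U * V)%g x = act U (act V x).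
Proof. exact: (rep_pi (mp_mul (rep (val U)) (rep (val V)))). Qed.

Lemma act1 : \forall x \ae mu, act (1%g : L1 T) x = x.
Proof. exact: (rep_pi (mp_one mu)). Qed.

Lemma L1_exists (S : mp_bij mu) (c : X -> int) :
  (\forall x \ae mu, S x = it (c x) x) -> integ (fun x => (c x)%:~R) ->
  exists2 U : L1 T, (\forall x \ae mu, cocycle U x = c x) &
    (\forall x \ae mu, act U x = S x).
Proof.
move=> Sc ic; pose u : mp_aut mu := \pi_(mp_aut mu)%qT S.
have uS : \forall x \ae mu, u x = S x by exact: rep_pi.
have cu : integrable_cocycle T u c.
  by split=> //; apply: filterS2 uS Sc => x -> ->.
have uL : u \in L1_full_group T by apply/L1_full_groupP; exists c.
exists (Sub u uL : L1 T) => //; apply: cocycle_uniq.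
by have [] := cu.
Qed.

Definition cdist U V x : R := `|(cocycle U x - cocycle V x)%:~R|.

Lemma cdist_integ U V : integ (cdist U V).
Proof. exact: L1_dist_integrable. Qed.

Lemma L1_dist_le U V (h : X -> R) : integ h ->
  (\forall x \ae mu, cdist U V x <= h x) -> L1_dist U V <= \int[mu]_x h x.
Proof. by move=> ih; apply: ae_le_Rintegral => //; exact: cdist_integ. Qed.

(** Composing on the right with a measure-preserving map moves the integrand
    without changing its integral. *)
Lemma L1_dist_mulr U V W : L1_dist (U * W)%g (V * W)%g = L1_dist U V.
Proof.
rewrite -[RHS](@Rintegral_mp _ _ _ _ (rep (val W)) (cdist U V)); last exact: cdist_integ.
apply: ae_eq_Rintegral; first exact: cdist_integ.
  exact: integ_mp (cdist_integ U V).
apply: filterS2 (cocycleM U W) (cocycleM V W) => x -> ->.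
by rewrite /cdist opprD addrACA subrr addr0.
Qed.

Lemma L1_indexM U V : L1_index (U * V)%g = L1_index U + L1_index V.
Proof.
have iUV := integ_mp (rep (val V)) (cocycle_integ U).
rewrite /L1_index -(Rintegral_mp (rep (val V)) (cocycle_integ U)).
rewrite -RintegralD //; last exact: cocycle_integ.
apply: ae_eq_Rintegral; first exact: cocycle_integ.
  by apply: integD => //; exact: cocycle_integ.
by apply: filterS (cocycleM U V) => x ->; rewrite intrD.
Qed.

Lemma L1_index1 : L1_index (1%g : L1 T) = 0.
Proof.
have := L1_indexM (1%g : L1 T) 1%g; rewrite mulg1 => E.
by apply: (addrI (L1_index (1%g : L1 T))); rewrite addr0 -E.
Qed.

Lemma L1_indexV U : L1_index U^-1%g = - L1_index U.
Proof.
by apply/eqP; rewrite -addr_eq0 -L1_indexM mulVg L1_index1.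
Qed.

Lemma L1_index_dist U V : `|L1_index U - L1_index V| <= L1_dist U V.
Proof.
rewrite /L1_index -RintegralB //; [|exact: cocycle_integ..].
apply: le_trans (le_normr_Rintegral _ _) _ => //.
  by apply: integB; exact: cocycle_integ.
apply: ae_le_Rintegral; last by apply: aeW => x; rewrite /= -intrB.
- by apply: integrable_norm; apply: integB; exact: cocycle_integ.
- exact: cdist_integ.
Qed.

(** Cocycles being integer-valued, two elements that are close in mean agree
    outside a small set. *)
Lemma mu_neq_cocycle U V :
  (mu [set x | cocycle U x != cocycle V x] <= (L1_dist U V)%:E)%E.
Proof.
set D := [set x | _].
have mD : measurable D by exact: measurable_neq_cocycle.
rewrite -(fineK (fin_num_measure mu _ mD)) lee_fin -Rintegral_indic //.
apply: ae_le_Rintegral; [exact: integrable_indic|exact: cdist_integ|].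
apply: aeW => x; rewrite indicE /cdist.
have [|/negbTE nD] := boolP (x \in D); last by rewrite normr_ge0.
rewrite inE /D /= -subr_eq0 => xD.
by rewrite -intr_norm (ler_int R 1); lia.
Qed.

(** Only points of [D] contribute, and [f] maps [D] to a set of the same
    measure: both [c] and [c \o f] are integrated over small sets. *)
Lemma displacement_small (c : X -> R) : integ c -> forall e, 0 < e ->
  exists2 dl, 0 < dl & forall f : mp_bij mu, forall D, measurable D ->
    (mu D < dl%:E)%E -> (\forall x \ae mu, ~ D x -> f x = x) ->
    \int[mu]_x `|c (f x) - c x| < e.
Proof.
move=> ic e e0; have e20 : 0 < e / 2 by rewrite divr_gt0.
have [dl dl0 hdl] := abs_continuity ic e20.
exists dl => // f D mD muD fD.
have inorm : integ (fun x => `|c x|) by exact: integrable_norm.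
pose E := mp_inv f @^-1` D.
have mE : measurable E by rewrite /E -[_ @^-1` _]setTI; exact: mp_inv_measurable.
have muE : (mu E < dl%:E)%E by rewrite mp_inv_preserving.
have iE := integ_indic mE inorm; have iD := integ_indic mD inorm.
have iEf := integ_mp f iE.
apply: (@le_lt_trans _ _ (\int[mu]_x (`|c (f x)| * \1_E (f x) + `|c x| * \1_D x))).
  apply: ae_le_Rintegral.
  - by apply: integrable_norm; apply: integB => //; exact: integ_mp.
  - exact: integD.
  apply: filterS fD => x fD.
  have EE : E (f x) = D x by rewrite /E /preimage /= mp_funK.
  have [Dx|nDx] := pselect (D x).
    by rewrite !indicE !mem_set ?EE // !mulr1 ler_normB.
  by rewrite fD // subrr normr0 addr_ge0 // mulr_ge0 // indicE.
rewrite RintegralD // [e]splitr; apply: ltrD.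
  rewrite (@Rintegral_mp _ _ _ _ f (fun x => `|c x| * \1_E x)) //.
  exact: hdl.
exact: hdl.
Qed.

(** With [W = V'^-1 V], right invariance turns the distance into that of [U W]
    to [U]. Now [W] is the identity wherever [V] and [V'] agree, and its cocycle
    is the difference of that of [V] and that of [V'] moved by [W]. *)
Lemma L1_dist_mulV_continuous U V e : 0 < e ->
  exists2 dl, 0 < dl & forall V', L1_dist V' V < dl ->
    L1_dist (U * V'^-1)%g (U * V^-1)%g < e.
Proof.
move=> e0; have e30 : 0 < e / 3 by rewrite divr_gt0.
have [d1 d10 h1] := displacement_small (cocycle_integ U) e30.
have [d2 d20 h2] := displacement_small (cocycle_integ V) e30.
exists (Num.min (e / 3) (Num.min d1 d2)); first by rewrite !lt_min e30 d10.
move=> V'; rewrite !lt_min => /and3P[V'e V'1 V'2].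
pose W := (V'^-1 * V)%g.
rewrite -(L1_dist_mulr _ _ V) -mulgA -/W -[X in L1_dist _ X]mulgA mulVg mulg1.
pose D := [set x | cocycle V' x != cocycle V x].
have mD : measurable D by exact: measurable_neq_cocycle.
have muD dl : L1_dist V' V < dl -> (mu D < dl%:E)%E.
  by move=> dV; apply: le_lt_trans (mu_neq_cocycle V' V) _; rewrite lte_fin.
have V'W : (V' * W)%g = V by rewrite /W mulgA mulgV mul1g.
have WD : \forall x \ae mu, ~ D x -> act W x = x.
  have := actM V' W; rewrite V'W.
  apply: filterS3 (cocycle_act V') (cocycle_act V) => x cV' cV E.
  move=> /negP; rewrite negbK => /eqP c.
  apply: (can_inj (@mp_funK _ _ _ _ (rep (val V')))).
  by rewrite -E cV cV' c.
apply: (@le_lt_trans _ _ (\int[mu]_x (`|(cocycle U (act W x))%:~R - (cocycle U x)%:~R|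
   + (cdist V' V (act W x) + `|(cocycle V (act W x))%:~R - (cocycle V x)%:~R| : R)))).
  apply: L1_dist_le.
    apply: integD; first by apply: integrable_norm; apply: integB;
      [apply: integ_mp (cocycle_integ U)|exact: cocycle_integ].
    apply: integD; first exact: integ_mp (cdist_integ _ _).
    by apply: integrable_norm; apply: integB;
      [apply: integ_mp (cocycle_integ V)|exact: cocycle_integ].
  have := cocycleM V' W; rewrite V'W.
  apply: filterS2 (cocycleM U W) => x EU EV; rewrite /cdist EU.
  rewrite -!intrB -!intr_norm -!intrD ler_int.
  have key (a w b p q r : int) : r = p + w ->
    `|a + w - b| <= `|a - b| + (`|p - q| + `|q - r|) by lia.
  exact: key.
have i1 : integ (fun x => `|(cocycle U (act W x))%:~R - (cocycle U x)%:~R| : R).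
  apply: integrable_norm; apply: integB; last exact: cocycle_integ.
  exact: integ_mp (cocycle_integ U).
have i2 : integ (fun x => cdist V' V (act W x)) by exact: integ_mp (cdist_integ _ _).
have i3 : integ (fun x => `|(cocycle V (act W x))%:~R - (cocycle V x)%:~R| : R).
  apply: integrable_norm; apply: integB; last exact: cocycle_integ.
  exact: integ_mp (cocycle_integ V).
rewrite RintegralD //; last exact: integD.
rewrite RintegralD // (Rintegral_mp _ (cdist_integ _ _)).
have := h1 (rep (val W)) D mD (muD _ V'1) WD.
have := h2 (rep (val W)) D mD (muD _ V'2) WD.
by move: V'e; rewrite /L1_dist -/(cdist V' V); lra.
Qed.

(** The cocycles of elements that agree with [U] on an exhausting sequence of
    sets and are trivial elsewhere are dominated by that of [U]. *)
Lemma L1_dist_exhaust U (V : nat -> L1 T) :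
  (\forall x \ae mu, forall n, cocycle (V n) x = 0 \/ cocycle (V n) x = cocycle U x) ->
  (\forall x \ae mu, exists N, forall n, (N <= n)%N -> cocycle (V n) x = cocycle U x) ->
  forall e, 0 < e -> exists n, L1_dist U (V n) < e.
Proof.
move=> V0U VU e e0.
have iU : integ (fun x => `|(cocycle U x)%:~R| : R).
  by apply: integrable_norm; exact: cocycle_integ.
have [|||n] := @eventually0_Rintegral _ _ _ _ (fun n => cdist U (V n)) _ _ iU _ _ _ e0.
- by move=> n; exact: integ_meas (cdist_integ _ _).
- apply: filterS V0U => x V0U n; rewrite /cdist normr_id.
  by case: (V0U n) => ->; rewrite ?subr0 // subrr normr0.
- apply: filterS VU => x [N VU]; exists N => n Nn.
  by rewrite /cdist VU // subrr normr0.
by move=> hn; exists n; apply: le_lt_trans hn; exact: ler_norm.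
Qed.

End cocycles.

(** * The L1 full group as a topological group *)

Section topology.
Context (R : realType) d (X : measurableType d) (mu : probability X R).
Context (T : mp_aut mu).
Hypothesis T_free : \forall x \ae mu, free_at T x.
Implicit Types (U V W : L1 T) (H : set (L1 T)).

Lemma closure_distP H U : closure H U <->
  forall e, 0 < e -> exists2 V, H V & L1_dist U V < e.
Proof.
split=> [HU e e0|HU B].
  have [V [HV UV]] := HU (ball U e) (nbhsx_ballx U e e0).
  by exists V.
rewrite -nbhs_ballE => -[e /= e0 eB]; have [V HV UV] := HU e e0.
by exists V; split=> //; exact: eB.
Qed.

Lemma closure_subgroup H : subgroup H -> subgroup (closure H).
Proof.
move=> sH; apply: subgroupP => [|U V /closure_distP HU /closure_distP HV].
  by apply: subset_closure; exact: subgroup1.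
apply/closure_distP => e e0; have e20 : 0 < e / 2 by rewrite divr_gt0.
have [dl dl0 hdl] := L1_dist_mulV_continuous T_free U V e20.
have [V' HV' VV'] := HV _ dl0; have [U' HU' UU'] := HU _ e20.
exists (U' * V'^-1)%g; first exact: subgroup_div.
apply: le_lt_trans (L1_dist_triangle (U * V'^-1)%g _ _) _.
rewrite [e]splitr ltrD //; last by rewrite (L1_dist_mulr T_free).
by rewrite L1_dist_sym hdl // L1_dist_sym.
Qed.

Lemma kernel_subgroup : subgroup [set U : L1 T | L1_index U = 0].
Proof.
apply: subgroupP => [|U V]; first exact: L1_index1.
by rewrite /mkset (L1_indexM T_free) (L1_indexV T_free) => -> ->; rewrite subr0.
Qed.

Lemma kernel_closed : closed [set U : L1 T | L1_index U = 0].
Proof.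
move=> U /closure_distP kU; rewrite /mkset; apply/eqP; rewrite -normr_le0.
apply/ler_addgt0Pr => e e0; rewrite add0r.
have [V V0 UV] := kU _ e0; have := L1_index_dist U V; rewrite V0 subr0.
by move/le_trans; apply; exact: ltW.
Qed.

(** Right translations are isometries, so the component of the identity is
    invariant under those that bring one of its points back to the identity. *)
Lemma component_subgroup : subgroup (connected_component [set: L1 T] 1%g).
Proof.
apply: subgroupP => [|U V KU KV]; first exact: connected_component_refl.
set K := connected_component _ _ in KU KV *.
have cK : connected ((fun W => W * V^-1)%g @` K).
  apply: connected_continuous_connected; first exact: component_connected.
  apply: continuous_subspaceT => W A; rewrite nbhs_simpl -!nbhs_ballE => -[e e0 eA].
  exists e => // W' WW'; apply: eA.
  have : L1_dist (W * V^-1)%g (W' * V^-1)%g < e by rewrite (L1_dist_mulr T_free).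
  exact.
apply: (connected_component_max _ _ cK) => //; last by exists U.
by exists V => //; rewrite mulgV.
Qed.

End topology.

(** * Swaps *)

Section swaps.
Context (R : realType) d (X : measurableType d) (mu : probability X R).
Context (T : mp_aut mu).
Hypothesis T_free : \forall x \ae mu, free_at T x.
Implicit Types (U V W S : L1 T) (A C G H : set X) (n l : int).
Local Notation integ h := (mu.-integrable setT (EFin \o h)).
Local Notation it := (iterz (rep T)).
Local Notation act U := (mp_fun (rep (val U))).

Definition displaced C n := forall x, C x -> ~ C (it n x).

Definition swap_cocycle C n x : int :=
  if x \in C then n else if it (- n) x \in C then - n else 0.

Definition swap_map C n x := it (swap_cocycle C n x) x.

Lemma swap_cocycle_in C n x : C x -> swap_cocycle C n x = n.
Proof. by move=> Cx; rewrite /swap_cocycle mem_set. Qed.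

Lemma swap_cocycle_out C n x : displaced C n -> C x ->
  swap_cocycle C n (it n x) = - n.
Proof.
move=> dC Cx; rewrite /swap_cocycle memNset; last exact: dC.
by rewrite iterzK mem_set.
Qed.

Lemma swap_cocycle_fix C n x : ~ C x -> ~ C (it (- n) x) -> swap_cocycle C n x = 0.
Proof. by move=> nC nC'; rewrite /swap_cocycle !memNset. Qed.

Lemma swap_map_in C n x : C x -> swap_map C n x = it n x.
Proof. by move=> Cx; rewrite /swap_map swap_cocycle_in. Qed.

Lemma swap_map_out C n x : displaced C n -> C x -> swap_map C n (it n x) = x.
Proof. by move=> dC Cx; rewrite /swap_map swap_cocycle_out // iterzK. Qed.

Lemma swap_map_fix C n x : ~ C x -> ~ C (it (- n) x) -> swap_map C n x = x.
Proof. by move=> nC nC'; rewrite /swap_map swap_cocycle_fix. Qed.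

Variant swap_spec C n x : Prop :=
| SwapIn of C x
| SwapOut y of C y & x = it n y
| SwapFix of ~ C x & ~ C (it (- n) x).

Lemma swapP C n x : swap_spec C n x.
Proof.
have [Cx|nCx] := pselect (C x); first exact: SwapIn.
have [Cx|nCx'] := pselect (C (it (- n) x)); last exact: SwapFix.
by apply: (SwapOut Cx); rewrite iterzNK.
Qed.

Lemma swap_cocycle_swap C n x : displaced C n ->
  swap_cocycle C n (swap_map C n x) = - swap_cocycle C n x.
Proof.
move=> dC; case: (swapP C n x) => [Cx|y Cy ->|nC nC'].
- by rewrite swap_map_in // swap_cocycle_out // swap_cocycle_in.
- by rewrite swap_map_out // swap_cocycle_out // swap_cocycle_in ?opprK.
- by rewrite swap_map_fix // swap_cocycle_fix ?oppr0.
Qed.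

Lemma swap_mapK C n : displaced C n -> involutive (swap_map C n).
Proof.
move=> dC x; rewrite {1}/swap_map swap_cocycle_swap //.
by rewrite /swap_map iterzK.
Qed.

Section swap_bijection.
Variables (C : set X) (n : int).
Hypotheses (mC : measurable C) (dC : displaced C n).

Let mCn : measurable (it (- n) @^-1` C). Proof. exact: measurable_iterz_pre. Qed.

Lemma swap_cocycleE x :
  (swap_cocycle C n x)%:~R = n%:~R * \1_C x - n%:~R * \1_(it (- n) @^-1` C) x :> R.
Proof.
case: (swapP C n x) => [Cx|y Cy ->|nC nC'].
- rewrite swap_cocycle_in // !indicE mem_set // memNset ?mulr0 ?mulr1 ?subr0 //.
  by move=> /dC; rewrite iterzNK.
- rewrite swap_cocycle_out // !indicE memNset ?mem_set /preimage/mkset ?iterzK //.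
    by rewrite mulr0 mulr1 sub0r intrN.
  exact: dC.
- by rewrite swap_cocycle_fix // !indicE !memNset // !mulr0 subrr.
Qed.

Lemma swap_cocycle_integ : integ (fun x => (swap_cocycle C n x)%:~R).
Proof.
have ci D : measurable D -> integ (fun x => n%:~R * \1_D x).
  move=> mD; apply: (integ_indic mD (h := cst n%:~R)).
  exact: finite_measure_integrable_cst.
apply: eq_integrable (integB (ci _ mC) (ci _ mCn)) => // x _ /=.
by rewrite swap_cocycleE.
Qed.

Lemma swap_map_preimage B : swap_map C n @^-1` B =
  (C `&` it n @^-1` B) `|` (it (- n) @^-1` (C `&` B) `|`
   (~` (C `|` it (- n) @^-1` C) `&` B)).
Proof.
apply/seteqP; split=> x; rewrite /preimage/mkset.
- case: (swapP C n x) => [Cx|y Cy ->|nC nC'].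
  + by rewrite swap_map_in // => Bx; left.
  + by rewrite swap_map_out // => By; right; left; rewrite /mkset iterzK.
  + by rewrite swap_map_fix // => Bx; right; right; split=> // -[].
- case=> [[Cx Bx]|[[Cx Bx]|[nC Bx]]].
  + by rewrite swap_map_in.
  + by rewrite -[x](iterzNK (rep T) n x) swap_map_out.
  + by rewrite swap_map_fix // => Cx; apply: nC; [left|right].
Qed.

Lemma measurable_swap_map : measurable_fun setT (swap_map C n).
Proof.
move=> _ B mB; rewrite setTI swap_map_preimage.
apply: measurableU; first by apply: measurableI => //; exact: measurable_iterz_pre.
apply: measurableU; first by apply: measurable_iterz_pre; exact: measurableI.
by apply: measurableI => //; apply: measurableC; exact: measurableU.
Qed.

Lemma swap_map_preserving B : measurable B -> mu (swap_map C n @^-1` B) = mu B.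
Proof.
move=> mB; rewrite swap_map_preimage.
have mCB : measurable (C `&` B) by exact: measurableI.
have m1 : measurable (C `&` it n @^-1` B).
  by apply: measurableI => //; exact: measurable_iterz_pre.
have m2 : measurable (it (- n) @^-1` (C `&` B)) by exact: measurable_iterz_pre.
have m3 : measurable (~` (C `|` it (- n) @^-1` C) `&` B).
  by apply: measurableI => //; apply: measurableC; exact: measurableU.
have m4 : measurable (it (- n) @^-1` C `&` B) by exact: measurableI.
have BE : B = (it (- n) @^-1` C `&` B) `|` ((C `&` B) `|`
   (~` (C `|` it (- n) @^-1` C) `&` B)).
  apply/seteqP; split=> [x Bx|x [[]|[[]|[]]]//].
  have [Cx|nC] := pselect (C x); first by right; left.
  have [Cx|nC'] := pselect (C (it (- n) x)); first by left.
  by right; right; split=> // -[].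
have E1 : mu (C `&` it n @^-1` B) = mu (it (- n) @^-1` C `&` B).
  rewrite -[RHS](iterz_preserving (rep T) n) //; congr (mu _).
  by apply/seteqP; split=> x [Cx Bx]; split=> //; move: Cx;
    rewrite /preimage/mkset iterzK.
have E2 : mu (it (- n) @^-1` (C `&` B)) = mu (C `&` B) by exact: iterz_preserving.
have d1 : C `&` B `&` (~` (C `|` it (- n) @^-1` C) `&` B) = set0.
  by apply/seteqP; split=> // x [[Cx _] [nC _]]; apply: nC; left.
have d2 : it (- n) @^-1` C `&` B `&`
    ((C `&` B) `|` (~` (C `|` it (- n) @^-1` C) `&` B)) = set0.
  apply/seteqP; split=> // x [[Cx Bx] [[Cx' _]|[nC _]]].
    by apply: (dC Cx); rewrite iterzNK.
  by apply: nC; right.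
have d3 : it (- n) @^-1` (C `&` B) `&` (~` (C `|` it (- n) @^-1` C) `&` B) = set0.
  by apply/seteqP; split=> // x [[Cx _] [nC _]]; apply: nC; right.
have d4 : C `&` it n @^-1` B `&` (it (- n) @^-1` (C `&` B) `|`
    (~` (C `|` it (- n) @^-1` C) `&` B)) = set0.
  apply/seteqP; split=> // x [[Cx Bx] [[Cx' _]|[nC _]]].
    by apply: (dC Cx'); rewrite iterzNK.
  by apply: nC; left.
rewrite [in RHS]BE !measureU //; first by congr (_ + (_ + _))%E; [exact: E1|exact: E2].
all: exact: measurableU.
Qed.

Definition swap_mp : mp_bij mu :=
  MpBij (swap_mapK dC) (swap_mapK dC) measurable_swap_map measurable_swap_map
    swap_map_preserving.

End swap_bijection.

Definition is_swap C n S := [/\ measurable C, displaced C n &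
  \forall x \ae mu, cocycle S x = swap_cocycle C n x].

Lemma swap_exists C n : measurable C -> displaced C n -> exists S, is_swap C n S.
Proof.
move=> mC dC.
have [|S SE _] := L1_exists T_free (S := swap_mp mC dC) _ (swap_cocycle_integ mC dC).
  exact: aeW.
by exists S.
Qed.

Lemma swap_act C n S : is_swap C n S -> \forall x \ae mu, act S x = swap_map C n x.
Proof.
by move=> [_ _ SE]; apply: filterS2 SE (cocycle_act S) => x E ->; rewrite E.
Qed.

Lemma is_swap_uniq C n S S' : is_swap C n S -> is_swap C n S' -> S = S'.
Proof.
move=> [_ _ SE] [_ _ S'E]; apply: act_eq_cocycle.
by apply: filterS2 SE S'E => x -> ->.
Qed.

Lemma act_inj U V : (\forall x \ae mu, act U x = act V x) -> U = V.
Proof.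
by move=> UV; apply/val_inj; rewrite -[LHS]repK -[RHS]repK; apply/aut_eqP.
Qed.

Lemma swap_involution C n S : is_swap C n S -> (S * S)%g = 1%g.
Proof.
move=> sS; have [_ dC _] := sS; apply: act_inj.
have aS := swap_act sS; have aSS := mp_ae (rep (val S)) aS.
apply: filterS (filterI (filterI aS aSS) (filterI (actM S S) (act1 T))).
by move=> x [[E E'] [-> ->]]; rewrite E' E swap_mapK.
Qed.

Lemma swapV C n S : is_swap C n S -> S^-1%g = S.
Proof. by move=> /swap_involution SS; apply: (mulgI S); rewrite mulgV. Qed.

Lemma is_swap0 n : is_swap set0 n 1%g.
Proof.
split=> //; apply: filterS (cocycle1 T_free) => x ->.
by rewrite swap_cocycle_fix.
Qed.

Lemma swap_union C G H n S S' : displaced C n -> G `<=` C -> H `<=` C ->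
  (forall x, G x -> ~ H x) -> is_swap G n S -> is_swap H n S' ->
  is_swap (G `|` H) n (S * S')%g.
Proof.
move=> dC GC HC GH [mG dG SE] sS'; have [mH dH S'E] := sS'.
have dU : displaced (G `|` H) n.
  by move=> x [/GC|/HC] /dC nC [/GC|/HC].
split=> //; first exact: measurableU.
have aS' := mp_ae (rep (val S')) SE.
apply: filterS (filterI (filterI aS' (swap_act sS'))
  (filterI S'E (cocycleM T_free S S'))).
move=> x [[E1 E2] [E3 ->]]; rewrite E1 E2 E3.
case: (swapP H n x) => [Hx|y Hy ->|nH nH'].
- rewrite swap_map_in // [swap_cocycle H _ _]swap_cocycle_in //.
  rewrite [in RHS]swap_cocycle_in; last by right.
  rewrite swap_cocycle_fix ?add0r // ?iterzK; last by move/GH.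
  by move=> /GC; apply: dC; exact: HC.
- rewrite swap_map_out // [swap_cocycle H _ _]swap_cocycle_out //.
  rewrite [in RHS]swap_cocycle_out //; last by right.
  rewrite swap_cocycle_fix ?add0r //; first by move/GH.
  by move=> /GC /dC; rewrite iterzNK; apply; exact: HC.
- rewrite swap_map_fix // [swap_cocycle H _ _]swap_cocycle_fix // addr0.
  have inGH z : ~ H z -> (z \in G) = (z \in G `|` H).
    by move=> nHz; apply/idP/idP => /set_mem h; apply/mem_set; [left|case: h].
  by rewrite /swap_cocycle !inGH.
Qed.

(** Let [u] swap [A] with [T^n A]. The swap [v] of [A] and [T^n A] with their
    [l]-th translates conjugates [u] to the swap of [T^l A] with [T^(n+l) A], so
    that [u (v u v)], which is the commutator of the two involutions, swaps both
    halves of [A] and [T^l A] with their [n]-th translates. *)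
Lemma swap_commutator C A n l S : displaced C n -> measurable A -> A `<=` C ->
  (forall x, A x -> C (it l x)) -> displaced A l ->
  is_swap (A `|` it (- l) @^-1` A) n S ->
  exists u v : L1 T, S = commg u v.
Proof.
move=> dC mA AC AlC dA sS.
have dAn : displaced A n by move=> x /AC /dC nC /AC.
pose B := A `|` it (- n) @^-1` A.
have mB : measurable B by apply: measurableU => //; exact: measurable_iterz_pre.
have itC a k m : it k (it m a) = it m (it k a) by rewrite -!iterzD addrC.
have dB : displaced B l.
  move=> x [Ax|Ax] [].
  - exact: dA.
  - rewrite /preimage/mkset => /AC/dC; rewrite iterzNK; apply; exact: AlC.
  - move=> /AC; rewrite -[x](iterzNK (rep T) n x) itC; apply: dC.
    exact: AlC.
  - by rewrite /preimage/mkset itC; exact: dA.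
have [u su] := swap_exists mA dAn; have [v sv] := swap_exists mB dB.
exists u, v; rewrite /commg /conjg (swapV su) (swapV sv).
apply: act_inj.
have au := swap_act su; have av := swap_act sv.
have a1 := av; have a2 := mp_ae (rep (val v)) au.
have a3 := mp_ae (rep (val v)) (mp_ae (rep (val u)) av).
have a4 := mp_ae (rep (val v)) (mp_ae (rep (val u)) (mp_ae (rep (val v)) au)).
have m1 := actM u (v * (u * v))%g; have m2 := actM v (u * v)%g; have m3 := actM u v.
apply: filterS (filterI (filterI (filterI a1 a2) (filterI a3 a4))
  (filterI (filterI m1 m2) (filterI m3 (swap_act sS)))).
move=> x [[[E1 E2] [E3 E4]] [[-> ->] [-> ->]]].
rewrite E4 E3 E2 E1 => {E1 E2 E3 E4}.
set G := A `|` _.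
have GC : G `<=` C.
  by move=> y [/AC//|]; rewrite /preimage/mkset => /AlC; rewrite iterzNK.
have dG : displaced G n by move=> y /GC /dC nC /GC.
have nAl y : A y -> ~ A (it l y) by exact: dA.
have u1 a : A a -> swap_map A n a = it n a by exact: swap_map_in.
have u2 a : A a -> swap_map A n (it n a) = a by exact: swap_map_out.
have u3 a : A a -> swap_map A n (it l a) = it l a.
  move=> Aa; apply: swap_map_fix; first exact: dA.
  by move=> /AC/dC; rewrite iterzNK; apply; exact: AlC.
have u4 a : A a -> swap_map A n (it n (it l a)) = it n (it l a).
  move=> Aa; apply: swap_map_fix; last by rewrite iterzK; exact: dA.
  by move=> /AC; apply: dC; exact: AlC.
have v1 a : A a -> swap_map B l a = it l a by move=> Aa; apply: swap_map_in; left.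
have v2 a : A a -> swap_map B l (it l a) = a.
  by move=> Aa; apply: swap_map_out => //; left.
have v3 a : A a -> swap_map B l (it n a) = it n (it l a).
  move=> Aa; rewrite swap_map_in; first exact: itC.
  by right; rewrite /preimage/mkset iterzK.
have v4 a : A a -> swap_map B l (it n (it l a)) = it n a.
  move=> Aa; rewrite itC swap_map_out //.
  by right; rewrite /preimage/mkset iterzK.
case: (swapP G n x) => [[Ax|Ax]|y [Ay|Ay] ->|nG nG'].
- by rewrite [LHS]swap_map_in; [rewrite (v1 x) // (u3 x) // (v2 x) // u1|left].
- have -> : x = it l (it (- l) x) by rewrite iterzNK.
  rewrite [LHS]swap_map_in.
    have := Ax; rewrite /preimage/mkset; move: (it (- l) x) => y Ay.
    by rewrite (v2 y) // (u1 y) // (v3 y) // u4.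
  by right; rewrite /preimage/mkset iterzK.
- by rewrite [LHS]swap_map_out //; [rewrite (v3 y) // (u4 y) // (v4 y) // u2|left].
- have -> : y = it l (it (- l) y) by rewrite iterzNK.
  rewrite [LHS]swap_map_out //.
    have := Ay; rewrite /preimage/mkset; move: (it (- l) y) => z Az.
    by rewrite (v4 z) // (u2 z) // (v1 z) // u3.
  by right; rewrite /preimage/mkset iterzK.
- have nu : swap_map A n x = x.
    by apply: swap_map_fix => h; [apply: nG; left|apply: nG'; left].
  have nv : swap_map B l x = x.
    apply: swap_map_fix => -[h|h]; first by apply: nG; left.
    + by apply: nG'; left.
    + by apply: nG; right.
    + by apply: nG'; right; rewrite /preimage/mkset itC.
  by rewrite nv nu nv nu swap_map_fix.
Qed.

End swaps.

(** * Limits of swaps *)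

Section swap_limits.
Context (R : realType) d (X : measurableType d) (mu : probability X R).
Context (T : mp_aut mu).
Hypothesis T_free : \forall x \ae mu, free_at T x.
Hypothesis mu_nonatomic : nonatomic mu.
Context (phi : X -> R) (mphi : measurable_fun setT phi) (phi_inj : injective phi).
Hypothesis phi02 : forall x, 0 <= phi x <= 2.
Implicit Types (U V W S : L1 T) (A C G H : set X) (n l : int).
Local Notation integ h := (mu.-integrable setT (EFin \o h)).
Local Notation it := (iterz (rep T)).
Local Notation act U := (mp_fun (rep (val U))).

Lemma swap_dist C C' n S S' D : is_swap C n S -> is_swap C' n S' -> measurable D ->
  (forall x, ~ D x -> (C x <-> C' x)) ->
  L1_dist S S' <= 4 * `|n|%:~R * fine (mu D).
Proof.
move=> [mC dC SE] [mC' dC' S'E] mD CC'.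
have mDn : measurable (it (- n) @^-1` D) by exact: measurable_iterz_pre.
have ic E : measurable E -> integ (fun x => 2 * `|n|%:~R * \1_E x).
  move=> mE; apply: (integ_indic mE (h := cst (2 * `|n|%:~R))).
  exact: finite_measure_integrable_cst.
have ii E : measurable E -> integ (\1_E : X -> R) by exact: integrable_indic.
apply: (@le_trans _ _ (\int[mu]_x
    (2 * `|n|%:~R * \1_D x + 2 * `|n|%:~R * \1_(it (- n) @^-1` D) x))).
  apply: L1_dist_le; first by apply: integD; exact: ic.
  apply: filterS2 SE S'E => x E E'; rewrite /cdist E E'.
  have b C0 : `|swap_cocycle T C0 n x| <= `|n|.
    by rewrite /swap_cocycle; case: ifP => _; [|case: ifP => _]; rewrite ?normrN ?normr0.
  have [Dx|nDx] := pselect (D x \/ D (it (- n) x)).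
    apply: (@le_trans _ _ (2 * `|n|%:~R)).
      rewrite -intr_norm -[2]/(2%:~R) -intrM ler_int.
      by have := b C; have := b C'; lia.
    have p01 (E0 : set X) : 0 <= 2 * `|n|%:~R * \1_E0 x :> R.
      by rewrite !mulr_ge0 // ?ler0z // indicE.
    case: Dx => Dx.
      by rewrite [\1_D x]indicE mem_set // mulr1 lerDl.
    by rewrite [X in _ + _ * X]indicE mem_set // mulr1 lerDr.
  have Ein z : ~ D z -> (z \in C) = (z \in C').
    by move=> /CC' [h h']; apply/idP/idP => /set_mem ?; apply/mem_set; auto.
  rewrite /swap_cocycle !Ein; [|by move=> h; apply: nDx; right
    |by move=> h; apply: nDx; left].
  rewrite subrr normr0 addr_ge0 // !mulr_ge0 // ?ler0z // indicE //.
rewrite RintegralD //; [|exact: ic..].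
rewrite !RintegralZl //; [|exact: ii..].
rewrite !Rintegral_indic //.
have -> : fine (mu (it (- n) @^-1` D)) = fine (mu D).
  by congr fine; exact: iterz_preserving.
by rewrite le_eqVlt; apply/orP; left; apply/eqP; ring.
Qed.

(** Cutting the base of a swap along the level sets of an injective function
    joins it to the identity by a path: fibres are null, so the cut moves
    continuously in measure. *)
Lemma swap_component C n S : is_swap C n S ->
  connected_component [set: L1 T] 1%g S.
Proof.
move=> sS; have [mC dC _] := sS.
pose Ct t := C `&` phi @^-1` `]-oo, t]%classic.
have mCt t : measurable (Ct t) by apply: measurableI => //; exact: measurable_phi_pre.
have dCt t : displaced T (Ct t) n by move=> x [/dC nC _] [/nC].
have /choice[g gP] : forall t, exists S', is_swap (Ct t) n S'.
  by move=> t; exact: swap_exists.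
have g0 : g (-1) = 1%g.
  apply: (is_swap_uniq (gP _)); rewrite (_ : Ct _ = set0); first exact: is_swap0.
  apply/seteqP; split=> // x [_]; rewrite /= in_itv /=; have := phi02 x; lra.
have g2 : g 2 = S.
  apply: (is_swap_uniq (gP _)); rewrite (_ : Ct _ = C) //.
  apply/seteqP; split=> [x []//|x Cx]; split=> //=; rewrite in_itv /=.
  by case/andP: (phi02 x).
have gc : continuous g.
  move=> t A; rewrite nbhs_simpl -nbhs_ballE => -[e e0 eA].
  pose k : R := 4 * `|n|%:~R + 1.
  have k0 : 0 < k by rewrite /k ltr_wpDl // mulr_ge0 // ler0z.
  have [r r0 hr] := fiber_nbhd_small mu_nonatomic mphi phi_inj t (divr_gt0 e0 k0).
  rewrite -nbhs_ballE; exists r => // t' tt'; apply: eA.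
  have mD : measurable (phi @^-1` `[t - r, t + r]%classic) by exact: measurable_phi_pre.
  suff : L1_dist (g t) (g t') < e by exact.
  apply: le_lt_trans (swap_dist (gP t) (gP t') mD _) _.
    move=> x; rewrite /Ct /= !in_itv /= => /negP; rewrite negb_and -!ltNge => h.
    move: tt'; rewrite /ball /= ltr_norml => /andP[h1 h2].
    by split=> -[Cx xt]; split=> //; case/orP: h => h; lra.
  apply: (@le_lt_trans _ _ (k * fine (mu (phi @^-1` `[t - r, t + r]%classic)))).
    by rewrite ler_wpM2r ?fine_ge0 // /k lerDl.
  rewrite mulrC -ltr_pdivlMr // -lte_fin fineK //; exact: fin_num_measure.
have cg : connected (g @` [set: R]).
  apply: connected_continuous_connected; first exact/connected_intervalP.
  exact: continuous_subspaceT.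
apply: (connected_component_max _ _ cg) => //; last by exists 2.
by exists (-1).
Qed.

(** The base of a swap is exhausted by finite unions of pairs [G, T^l G], on
    each of which the swap is a commutator. The pairs are picked greedily along
    an enumeration of the [l] and of the rational levels separating a point from
    its [l]-th translate; what is never picked meets an orbit at most once. *)
Lemma swap_in_closure_derived C n S : is_swap C n S ->
  closure (derived_subgroup [set: L1 T]) S.
Proof.
move=> sS; have [mC dC SE] := sS.
set D := derived_subgroup _.
have sD : subgroup D by exact: generated_subgroupP.
pose code j : int * rat := odflt (0, 0) (unpickle j).
pose E c := [set x | phi x < ratr c.2 /\ ratr c.2 < phi (it c.1 x)].
have mE c : measurable (E c).
  have -> : E c = phi @^-1` `]-oo, (ratr c.2)[%classic `&`
      it c.1 @^-1` (phi @^-1` `](ratr c.2), +oo[%classic).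
    by apply/seteqP; split=> x; rewrite /E /= !in_itv /= andbT => -[].
  apply: measurableI; first exact: measurable_phi_pre.
  by apply: measurable_iterz_pre; exact: measurable_phi_pre.
pose base c (A : set X) := A `&` it c.1 @^-1` A `&` E c.
pose pair c (A : set X) := base c A `|` it (- c.1) @^-1` base c A.
pose A := fix A j := if j is j'.+1 then A j' `\` pair (code j') (A j') else C.
have mbase c B : measurable B -> measurable (base c B).
  move=> mB; apply: measurableI => //; apply: measurableI => //.
  exact: measurable_iterz_pre.
have mpair c B : measurable B -> measurable (pair c B).
  move=> mB; apply: measurableU; first exact: mbase.
  by apply: measurable_iterz_pre; exact: mbase.
have mA j : measurable (A j).
  by elim: j => [//|j IH] /=; apply: measurableD => //; exact: mpair.
have pairA c B : pair c B `<=` B.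
  by move=> x [[[]]//|[[_]]]; rewrite /preimage/mkset iterzNK.
have AC j : A j `<=` C by elim: j => [//|j IH] x [/IH].
have Adec i j : (i <= j)%N -> A j `<=` A i.
  elim: j => [|j IH]; first by rewrite leqn0 => /eqP ->.
  by rewrite leq_eqVlt => /orP[/eqP ->//|]; rewrite ltnS => /IH ij x [/ij].
pose H j := C `\` A j.
have mH j : measurable (H j) by exact: measurableD.
have dH j : displaced T (H j) n by move=> x [/dC nC _] [/nC].
have HS j : H j.+1 = H j `|` pair (code j) (A j).
  apply/seteqP; split=> x.
    move=> [Cx nAx]; have [Ax|] := pselect (A j x); last by left.
    by right; apply: contrapT => npx; apply: nAx.
  by move=> [[Cx nA]|px]; split=> //; [case|exact: (AC j _ (pairA _ _ _ px))|case].
have /choice[s sP] : forall j, exists S', is_swap (H j) n S'.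
  by move=> j; exact: swap_exists.
have sD' j : D (s j).
  elim: j => [|j IH].
    have -> : s 0%N = 1%g.
      apply: (is_swap_uniq (sP _)); rewrite (_ : H 0%N = set0); first exact: is_swap0.
      by apply/seteqP; split=> // x [].
    exact: subgroup1.
  have dP : displaced T (pair (code j) (A j)) n.
    by move=> x /pairA/AC/dC nC /pairA/AC.
  have [K sK] := swap_exists T_free (mpair (code j) _ (mA j)) dP.
  have -> : s j.+1 = (s j * K)%g.
    apply: (is_swap_uniq (sP _)); rewrite HS; apply: (swap_union T_free dC) => //.
    - by move=> x [].
    - by move=> x /pairA/AC.
    - by move=> x [_ nA] /pairA.
  apply: (subgroupM sD IH); apply: subset_generated_subgroup.
  have [|||u [v ->]] := swap_commutator T_free dC (mbase (code j) _ (mA j)) _ _ _ sK.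
  - by move=> x [[/AC]].
  - by move=> x [[_ /AC]].
  - by move=> x [_ [_ h]] [_ [h' _]]; move: h h'; lra.
  - by exists u => //; exists v.
pose Aoo := \bigcap_j A j.
have Aoo0 : mu Aoo = 0%E.
  apply: (@wandering_mu0 _ _ _ _ (rep T)); first exact: bigcapT_measurable.
  move=> k; apply: filterS T_free => x fx Ax Akx.
  have sep l z : Aoo z -> Aoo (it l z) -> ~ phi z < phi (it l z).
    move=> Az Alz /rat_in_itvoo[q]; rewrite in_itv /= => /andP[zq qz].
    have := Az (pickle (l, q)).+1 I; case=> _; apply; left.
    rewrite /code pickleK /=; split=> //; split; [exact: Az|exact: Alz].
  have : phi x != phi (it k.+1 x).
    by apply/negP => /eqP/phi_inj/esym; exact: fx.
  rewrite neq_lt => /orP[|]; first exact: sep.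
  have := @sep (- k.+1%:Z) (it k.+1 x) Akx; rewrite iterzK; exact.
have mAoo : measurable Aoo by exact: bigcapT_measurable.
apply/closure_distP => e e0.
have [||j jS] := L1_dist_exhaust (U := S) (V := s) _ _ e0; last by exists (s j).
- have : \forall x \ae mu, forall j, cocycle (s j) x = swap_cocycle T (H j) n x.
    by apply: ae_all_count => j; have [] := sP j.
  apply: filterS2 SE => x -> + j => ->.
  case: (swapP T (H j) n x) => [Hx|y Hy ->|nH nH'].
  + by right; rewrite !swap_cocycle_in //; case: Hx.
  + by right; rewrite !swap_cocycle_out //; case: Hy.
  + by left; exact: swap_cocycle_fix.
- have : \forall x \ae mu, forall j, cocycle (s j) x = swap_cocycle T (H j) n x.
    by apply: ae_all_count => j; have [] := sP j.
  have nAoo := ae_orbit (rep T) (mu0_ae_notin mAoo Aoo0).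
  apply: filterS3 SE nAoo => x -> nAoo sE.
  have ev y : C y -> ~ Aoo y -> exists N, forall j, (N <= j)%N -> H j y.
    move=> Cy /existsNP[N /not_implyP[_ nAN]]; exists N => j Nj; split=> //.
    by move=> /(Adec _ _ Nj).
  case: (swapP T C n x) => [Cx|y Cy xE|nC nC'].
  + have [N hN] := ev x Cx (nAoo 0); exists N => j /hN Hx.
    by rewrite sE !swap_cocycle_in.
  + have [|N hN] := ev y Cy; first by have := nAoo (- n); rewrite xE iterzK.
    by exists N => j /hN Hy; rewrite sE xE !swap_cocycle_out.
  + exists 0%N => j _; rewrite sE !swap_cocycle_fix //; first by case.
    by case.
Qed.

End swap_limits.

(** * Periodic elements *)

Section periodic_elements.
Context (R : realType) d (X : measurableType d) (mu : probability X R).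
Context (T : mp_aut mu).
Hypothesis T_free : \forall x \ae mu, free_at T x.
Implicit Types (U V W S : L1 T).
Local Notation integ h := (mu.-integrable setT (EFin \o h)).
Local Notation it := (iterz (rep T)).
Local Notation act U := (mp_fun (rep (val U))).

Lemma involution_periodic U : is_involution U -> is_periodic (val U).
Proof.
move=> UU; have := actM U U; rewrite (UU : (U * U)%g = 1%g).
apply: filterS2 (act1 T) => x -> /esym UUx.
apply: (@sub_finite_set _ _ [set x; act U x]); last by rewrite finite_setU.
move=> _ [n _ <-].
have iUx : mp_inv (rep (val U)) x = act U x by rewrite -[in LHS]UUx mp_funK.
elim/int_rec: n => [|n IH|n IH]; first by left.
- by rewrite intS iterz_succ; case: IH => ->; [right|left].
- rewrite (_ : - n.+1%:Z = - n%:Z - 1); last lia.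
  by rewrite iterz_pred; case: IH => ->; [right|left; rewrite mp_funK].
Qed.

(** On the set of points whose period divides [N!], the cocycle of the
    [N!]-th power vanishes, while its integral there is [N!] times that of the
    cocycle. These sets increase to a conull set. *)
Lemma periodic_index U : is_periodic (val U) -> L1_index U = 0.
Proof.
move=> pU.
pose u : mp_bij mu := rep (val U).
pose Q N := [set x | cocycle (U ^+ N`!)%g x = 0].
have mQ N : measurable (Q N) by exact: (measurable_cocycle _ (fun m => m = 0)).
have coE : \forall x \ae mu, forall N : nat, act (U ^+ N)%g x = iter N u x.
  apply: ae_all_count; elim=> [|N IH]; first by rewrite expg0; exact: act1.
  by rewrite expgS; apply: filterS2 (actM U (U ^+ N)%g) IH => x -> ->.
have cS : \forall x \ae mu, forall N : nat,
    cocycle (U ^+ N)%g x = \sum_(i < N) cocycle U (iter i u x).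
  apply: ae_all_count; elim=> [|N IH].
    by rewrite expg0; apply: filterS (cocycle1 T_free) => x ->; rewrite big_ord0.
  rewrite expgS; apply: filterS3 (cocycleM T_free U (U ^+ N)%g) IH coE => x -> -> ->.
  by rewrite big_ord_recr /= addrC.
have QE : \forall x \ae mu, forall N, Q N x <-> iter N`! u x = x.
  have ca : \forall x \ae mu, forall N : nat,
      act (U ^+ N)%g x = it (cocycle (U ^+ N)%g x) x.
    by apply: ae_all_count => N; exact: cocycle_act.
  apply: filterS3 T_free coE ca => x fx aE ca N; rewrite -aE ca /Q /mkset.
  split=> [->//|E]; apply/eqP/negP => /negP; move/fx; exact.
have Qu : \forall x \ae mu, forall N, Q N (u x) <-> Q N x.
  apply: filterS2 QE (mp_ae u QE) => x Qx Qux N.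
  rewrite Qx Qux -iterSr iterS; split=> [|->//].
  exact: (can_inj (@mp_funK _ _ _ _ u)).
have QuI : \forall x \ae mu, forall N (i : nat), Q N (iter i u x) <-> Q N x.
  have : \forall x \ae mu, forall i : nat, forall N,
      Q N (u (iter i u x)) <-> Q N (iter i u x).
    by apply: ae_all_count => i; exact: (mp_ae (mp_pow u i) Qu).
  apply: filterS => x h N; elim=> [//|i IH]; rewrite iterS; split=> [/h/IH//|/IH/h//].
have iQ N : integ (fun x => (cocycle U x)%:~R * \1_(Q N) x).
  by apply: integ_indic => //; exact: cocycle_integ.
have intQ0 N : \int[mu]_x ((cocycle U x)%:~R * \1_(Q N) x) = 0 :> R.
  pose h x : R := (cocycle U x)%:~R * \1_(Q N) x.
  have ih : integ h by exact: iQ.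
  have hsum (M : nat) : integ (fun x => \sum_(i < M) h (iter i u x)) /\
      \int[mu]_x (\sum_(i < M) h (iter i u x)) = M%:R * \int[mu]_x h x.
    elim: M => [|M [IH1 IH2]].
      have E : (fun x => \sum_(i < 0) h (iter i u x)) = cst 0.
        by apply/funext => x; rewrite big_ord0.
      rewrite E mul0r; split; first exact: integrable0.
      by rewrite Rintegral_cst // mul0r.
    have E : (fun x => \sum_(i < M.+1) h (iter i u x)) =
        (fun x => \sum_(i < M) h (iter i u x) + h (iter M u x)).
      by apply/funext => x; rewrite big_ord_recr.
    have iM := integ_mp (mp_pow u M) ih.
    rewrite E; split; first exact: integD.
    rewrite RintegralD // IH2 (Rintegral_mp (mp_pow u M) ih).
    by rewrite -natr1 mulrDl mul1r.
  have [iS] := hsum N`!; rewrite (@ae_eq_Rintegral _ _ _ _ _ (cst 0)) //.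
  - rewrite Rintegral_cst // mul0r => /esym/eqP; rewrite mulf_eq0 pnatr_eq0.
    by rewrite -leqn0 leqNgt fact_gt0 /= => /eqP.
  - exact: integrable0.
  apply: filterS2 QuI cS => x Qx cx; rewrite /h.
  have [Qx0|nQx] := pselect (Q N x).
    rewrite (eq_bigr (fun i : 'I_(N`!) => (cocycle U (iter i u x))%:~R)); last first.
      by move=> i _; rewrite indicE mem_set ?mulr1 //; exact/Qx.
    by rewrite -rmorph_sum /= -cx Qx0.
  by rewrite big1 // => i _; rewrite indicE memNset ?mulr0 // => /Qx.
have per : \forall x \ae mu, exists N, forall n, (N <= n)%N -> Q n x.
  apply: filterS2 pU QE => x fx Qx.
  have [p p0 px] : exists2 p : nat, (0 < p)%N & iter p u x = x.
    apply: contrapT => np; apply: infinite_nat.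
    have -> : [set: nat] = (fun n => iter n u x) @^-1` mp_orbit u x.
      by apply/seteqP; split=> // n _; exists n.
    apply: finite_preimage fx => m n _ _.
    wlog mn : m n / (m <= n)%N => [h mn|].
      by have [/h|/ltnW/h] := leqP m n; [exact|move=> /(_ (esym mn))].
    rewrite -{1}(subnK mn) iterD => E; apply/eqP; rewrite eqn_leq mn leqNgt /=.
    apply/negP => lmn; apply: np; exists (n - m)%N; first by rewrite subn_gt0.
    have inj := can_inj (@iterzK _ _ _ _ u m%:Z).
    by apply: inj; rewrite /iterz -iterD addnC iterD -E.
  exists p => n pn; apply/Qx.
  have /dvdnP[k ->] : (p %| n`!)%N by rewrite dvdn_fact // p0.
  by elim: k => // k IH; rewrite mulSn iterD IH px.
have mQc N : measurable (~` Q N) by exact: measurableC.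
have iQc N : integ (fun x => (cocycle U x)%:~R * \1_(~` Q N) x).
  by apply: integ_indic => //; exact: cocycle_integ.
have split N : L1_index U = \int[mu]_x ((cocycle U x)%:~R * \1_(~` Q N) x).
  rewrite -[RHS]add0r -(intQ0 N) -RintegralD //.
  apply: eq_Rintegral => x _; rewrite -mulrDr !indicE in_setC.
  by case: (_ \in _); rewrite /= ?addr0 ?add0r mulr1.
apply/eqP; rewrite -normr_le0; apply/ler_addgt0Pr => e e0; rewrite add0r.
have [||||N] := @eventually0_Rintegral _ _ _ mu
  (fun N x => (cocycle U x)%:~R * \1_(~` Q N) x)
  (fun x => `|(cocycle U x)%:~R|) _ _ _ _ _ e0.
- by move=> N; exact: integ_meas (iQc N).
- by apply: integrable_norm; exact: cocycle_integ.
- apply: aeW => x N; rewrite normrM ler_piMr // indicE; case: (_ \in _) => /=.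
    by rewrite normr1.
  by rewrite normr0.
- apply: filterS per => x [N QN]; exists N => n /QN Qn.
  by rewrite indicE memNset ?mulr0 //; apply.
by rewrite -split => /ltW.
Qed.

End periodic_elements.

(** * Jumps over a point of an orbit *)

Section crossings.
Context (R : realType) d (X : measurableType d) (mu : probability X R).
Context (T : mp_aut mu).
Hypothesis T_free : \forall x \ae mu, free_at T x.
Context (phi : X -> R) (mphi : measurable_fun setT phi) (phi_inj : injective phi).
Implicit Types (U V W S P : L1 T) (A B C : set X) (b : int -> bool).
Local Notation integ h := (mu.-integrable setT (EFin \o h)).
Local Notation it := (iterz (rep T)).
Local Notation act U := (mp_fun (rep (val U))).

(** The indicators of the events [n <= |c|] sum up to [|c| + 1]. *)
Lemma cocycle_tail_summable U :
  (\sum_(0 <= n <oo) mu [set x | (n%:Z <= `|cocycle U x|)%R] < +oo)%E.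
Proof.
pose E n := [set x | n%:Z <= `|cocycle U x|].
have mE n : measurable (E n) by exact: (measurable_cocycle _ (fun m => n%:Z <= `|m|)).
have iE n : integ (\1_(E n) : X -> R) by exact: integrable_indic.
pose g x : R := `|(cocycle U x)%:~R| + 1.
have ig : integ g.
  apply: integD; first by apply: integrable_norm; exact: cocycle_integ.
  exact: (@finite_measure_integrable_cst _ _ _ _ setT 1).
have bnd (N : nat) : (\sum_(0 <= n < N) mu (E n) <= (\int[mu]_x g x)%:E)%E.
  have -> : (\sum_(0 <= n < N) mu (E n) =
      (\int[mu]_x (\sum_(0 <= n < N) \1_(E n) x))%:E)%E.
    rewrite (eq_bigr (fun n => (\int[mu]_x \1_(E n) x)%:E)); last first.
      by move=> n _; rewrite Rintegral_indic // fineK // fin_num_measure.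
    rewrite sumEFin; congr (_%:E).
    suff [_ //] : integ (fun x => \sum_(0 <= n < N) \1_(E n) x : R) /\
        \sum_(0 <= n < N) \int[mu]_x \1_(E n) x =
        \int[mu]_x (\sum_(0 <= n < N) \1_(E n) x) :> R.
    elim: N => [|N [iN IN]].
      rewrite big_geq // (_ : (fun x => _) = cst 0); last first.
        by apply/funext => x; rewrite big_geq.
      by rewrite Rintegral_cst // mul0r; split=> //; exact: integrable0.
    rewrite (_ : (fun x => _) = (fun x => \sum_(0 <= n < N) \1_(E n) x + \1_(E N) x : R)).
      split; first exact: integD.
      by rewrite RintegralD // -IN big_nat_recr.
    by apply/funext => x; rewrite big_nat_recr.
  rewrite lee_fin; apply: ae_le_Rintegral => //.
    elim: N => [|N IN].
      rewrite (_ : (fun x => _) = cst 0); first exact: integrable0.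
      by apply/funext => x; rewrite big_geq.
    rewrite (_ : (fun x => _) = (fun x => \sum_(0 <= n < N) \1_(E n) x + \1_(E N) x : R)).
      exact: integD.
    by apply/funext => x; rewrite big_nat_recr.
  apply: aeW => x; rewrite /g -intr_norm.
  have -> : \sum_(0 <= n < N) \1_(E n) x =
      (\sum_(0 <= n < N) (n%:Z <= `|cocycle U x|)%R)%:R :> R.
    rewrite natr_sum; apply: eq_bigr => n _; rewrite indicE; congr (_ %:R).
    by congr nat_of_bool; apply/idP/idP; rewrite inE.
  have : (\sum_(0 <= n < N) (n%:Z <= `|cocycle U x|)%R <= (absz (cocycle U x)).+1)%N.
    rewrite -abszE; move: (absz _) => a.
    have : (\sum_(0 <= n < N) (n%:Z <= a%:Z)%R <= minn N a.+1)%N.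
      by elim: N => [|N IN]; [rewrite big_geq|rewrite big_nat_recr //=; lia].
    by move/leq_trans; apply; lia.
  by rewrite -(ler_nat R) -natr1 natr_absz.
apply: (@le_lt_trans _ _ (\int[mu]_x g x)%:E); last exact: ltry.
apply: lime_le; first by apply: is_cvg_nneseries => n _ _; exact: measure_ge0.
exact: nearW.
Qed.

(** By the Borel-Cantelli lemma, integrability of the cocycle bounds how far
    from a given point jumps over it can start. *)
Lemma cocycle_sublinear U : \forall x \ae mu, exists M : nat, forall m : int,
  M%:Z <= `|m| -> `|cocycle U (it m x)| < `|m|.
Proof.
pose E (n : nat) := [set x | (n%:Z <= `|cocycle U x|)%R].
have mE n : measurable (E n) by exact: (measurable_cocycle _ (fun m => n%:Z <= `|m|)).
have BC (s : nat -> int) : \forall x \ae mu, exists M : nat, forall n : nat,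
    (M <= n)%N -> ~ E n (it (s n) x).
  pose F n := it (s n) @^-1` E n.
  have mF n : measurable (F n) by exact: measurable_iterz_pre.
  have F0 : mu (lim_sup_set F) = 0%E.
    apply: lim_sup_set_cvg0 => //.
    rewrite (eq_eseriesr (g := fun n => mu (E n))); first exact: cocycle_tail_summable.
    by move=> n _; exact: iterz_preserving.
  have mFs : measurable (lim_sup_set F).
    apply: bigcapT_measurable => n; exact: bigcup_measurable.
  apply: filterS (mu0_ae_notin mFs F0) => x /existsNP[N /not_implyP[_ nF]].
  by exists N => n Nn Ex; apply: nF; exists n.
apply: filterS2 (BC Posz) (BC (fun n => - n%:Z)) => x [M1 h1] [M2 h2].
exists (maxn M1 M2) => -[n|n] nM; rewrite ltNge; apply/negP => h.
  by apply: (h1 n) => //; lia.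
by apply: (h2 n.+1); [lia|rewrite /E /mkset -NegzE; lia].
Qed.

Definition spaced A (N : nat) := forall x (l : nat), A x -> (0 < l < N)%N -> ~ A (it l x).

Lemma spacedP A N x (k : int) : spaced A N -> A x -> A (it k x) ->
  k = 0 \/ N%:Z <= `|k|.
Proof.
move=> sA Ax Ak; have [->|k0] := eqVneq k 0; first by left.
right; rewrite leNgt; apply/negP => kN.
have [kp|kn] := leP 0 k.
  by apply: (sA x `|k|%N Ax); [lia|rewrite gez0_abs].
apply: (sA _ `|k|%N Ak); first lia.
by rewrite -iterzD (_ : _ + _ = 0) //; lia.
Qed.

(** Rational levels of an injective function separate a point from its [l]-th
    translate, so [A] is covered by countably many sets that do not meet their
    [l]-th translates. This is applied to each [l] in turn. *)
Lemma exists_spaced A N : measurable A -> (0 < mu A)%E ->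
  exists B, [/\ measurable B, B `<=` A, (0 < mu B)%E & spaced B N].
Proof.
move=> mA A0; elim: N => [|N [B [mB BA B0 sB]]].
  by exists A; split=> // x l _ /andP[].
have [N0|Np] := posnP N.
  by exists B; split=> // x l _; rewrite N0; case: l => [//|l] /andP[_]; lia.
pose F (c : rat * bool) := if c.2
  then [set x | phi x < ratr c.1 /\ ratr c.1 < phi (it N x)]
  else [set x | phi (it N x) < ratr c.1 /\ ratr c.1 < phi x].
have mF c : measurable (F c).
  have m1 : measurable (phi @^-1` `]-oo, (ratr c.1)[%classic).
    exact: measurable_phi_pre.
  have m2 : measurable (phi @^-1` `](ratr c.1), +oo[%classic).
    exact: measurable_phi_pre.
  rewrite /F; case: c.2.
    rewrite (_ : mkset _ = phi @^-1` `]-oo, (ratr c.1)[%classic `&`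
        it N @^-1` (phi @^-1` `](ratr c.1), +oo[%classic)).
      by apply: measurableI => //; exact: measurable_iterz_pre.
    by apply/seteqP; split=> x; rewrite /= !in_itv /= andbT => -[].
  rewrite (_ : mkset _ = it N @^-1` (phi @^-1` `]-oo, (ratr c.1)[%classic) `&`
      phi @^-1` `](ratr c.1), +oo[%classic).
    by apply: measurableI => //; exact: measurable_iterz_pre.
  by apply/seteqP; split=> x; rewrite /= !in_itv /= andbT => -[].
have [|c c0] := ae_exists_pos_in mB B0 mF.
  apply: filterS T_free => x fx _.
  have : phi x != phi (it N x).
    by apply/negP => /eqP/phi_inj/esym; apply: fx; lia.
  rewrite neq_lt => /orP[] /rat_in_itvoo[q]; rewrite in_itv /= => /andP[h1 h2].
    by exists (q, true).
  by exists (q, false).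
exists (B `&` F c); split=> //; [exact: measurableI|by move=> x [/BA]|].
move=> x l [Bx Fx] /andP[l0]; rewrite ltnS leq_eqVlt => /orP[/eqP lN|lN] [Bl Fl].
  move: Fx Fl; rewrite lN /F; case: c.2 => -[h1 h2] [h3 h4].
    by have := lt_trans h2 h3; rewrite ltxx.
  by have := lt_trans h1 h4; rewrite ltxx.
by apply: (sB x l Bx) Bl; rewrite l0.
Qed.

(** The orbit of [x] being identified with the integers, [m + c_U] is where [U]
    sends the point [m]; asking for the same [b] at all points of [A] makes the
    crossing of [x] by [U] a matter of finite combinatorics. *)
Definition jumps U A b := \forall x \ae mu,
  A x -> forall m : int, (0 <= m + cocycle U (it m x)) = b m.

Definition swaps : set (L1 T) := [set S | exists C n, is_swap C n S].

(** The jumps over the origin are counted in a window of radius [M]: forward ones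
    by [ups], backward ones by [downs]. *)
Definition ups b (M : nat) : nat := (\sum_(i < M) b (- i%:Z - 1)%R)%N.

Definition downs b (M : nat) : nat := (\sum_(j < M) ~~ b j%:Z)%N.

(** Each swap exchanges an orbit point jumping over [x] forward with one jumping
    backward, so that neither crosses [x] anymore. The window of the crossing
    points is shorter than the gaps of [A], so the swaps made around distinct
    points of [A] do not interfere. *)
Lemma balanced_uncross U A b M : measurable A -> spaced A (2 * M) ->
  jumps U A b -> (forall m : int, m < - M%:Z \/ M%:Z <= m -> b m = (0 <= m)) ->
  ups b M = downs b M ->
  exists2 P, generated_subgroup swaps P & jumps (U * P)%g A (fun m => 0 <= m).
Proof.
move=> mA sA; have [N] := ubnP (ups b M).
elim: N U b => // N IH U b; rewrite ltnS => bN Ub bM bal.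
have [b0|] := posnP (ups b M).
  exists 1%g; first exact: (subgroup1 (generated_subgroupP _)).
  rewrite mulg1; apply: filterS Ub => x Ub Ax m; rewrite (Ub Ax).
  have [mM|mM] := boolP ((m < - M%:Z) || (M%:Z <= m)).
    by apply: bM; case/orP: mM; [left|right].
  have [m0|m0] := leP 0 m.
    have mM' : (`|m| < M)%N by lia.
    move/eqP: (esym bal); rewrite b0 /downs sum_nat_eq0 => /forallP/(_ (Ordinal mM')) /=.
    by rewrite eqb0 negbK gez0_abs.
  have mM' : (`|m|.-1 < M)%N by lia.
  move/eqP: b0; rewrite /ups sum_nat_eq0 => /forallP/(_ (Ordinal mM')) /=.
  by rewrite eqb0 (_ : - _ - 1 = m) => [/negbTE|]; lia.
move=> bp.
have [i bi] : exists i : 'I_M, b (- i%:Z - 1).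
  apply: contrapT => /forallNP nb; move: bp; rewrite /ups big1 // => i _.
  by have /negP/negbTE -> := nb i.
have [j bj] : exists j : 'I_M, ~~ b j%:Z.
  apply: contrapT => /forallNP nb; move: bp; rewrite bal /downs big1 // => j _.
  by have /negP/negbTE -> := nb j.
(* the swap exchanges the points of indices [- (i + 1)] and [j] relative to [A] *)
pose C := it (i%:Z + 1) @^-1` A; pose n := i%:Z + j%:Z + 1.
have iM := ltn_ord i; have jM := ltn_ord j.
have dC : displaced T C n.
  move=> x Ax An; have {}An : A (it n (it (i%:Z + 1) x)).
    by move: An; rewrite /C/preimage/mkset -!iterzD addrC.
  by have := spacedP sA Ax An; rewrite /n; lia.
have mC : measurable C by exact: measurable_iterz_pre.
have [S sS] := swap_exists T_free mC dC.
pose b' m := if m == - i%:Z - 1 then false else if m == j%:Z then true else b m.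
have Ub' : jumps (U * S)%g A b'.
  have [_ _ SE] := sS.
  apply: filterS3 Ub (ae_orbit (rep T) SE)
    (ae_orbit (rep T) (filterI (cocycleM T_free U S) (cocycle_act S))).
  move=> x Ub cS cUS Ax m.
  have [-> ->] := cUS m; rewrite cS -iterzD.
  (* outside the window of [x] the swap may act around another point of [A], but
     too far from [x] to change the side on which the point lies *)
  have pos k : A (it k x) -> k = 0 \/ (2 * M)%N%:Z <= `|k| by exact: spacedP.
  rewrite addrCA addrC [m + _]addrC Ub //.
  case: (swapP T C n (it m x)) => [Cm|y Cy mE|nC nC'].
  - rewrite swap_cocycle_in //.
    have := pos (i%:Z + 1 + m); rewrite iterzD => /(_ Cm) km.
    rewrite /b'; have [mi|mi] := eqVneq m (- i%:Z - 1).
      by rewrite (_ : n + m = j%:Z) ?(negbTE bj) //; rewrite /n; lia.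
    rewrite ifF; last by apply/negbTE; lia.
    by rewrite !bM /n; lia.
  - have yE : y = it (m - n) x by rewrite addrC iterzD mE iterzK.
    rewrite mE swap_cocycle_out // [- n + m]addrC.
    have := pos (i%:Z + 1 + (m - n)); rewrite iterzD -yE => /(_ Cy) km.
    rewrite /b'; have [mj|mj] := eqVneq m j%:Z.
      rewrite ifF; last by apply/negbTE; lia.
      by rewrite (_ : m - n = - i%:Z - 1) //; rewrite /n; lia.
    rewrite ifF; last by apply/negbTE; rewrite /n in km; lia.
    by rewrite !bM; rewrite /n in km *; lia.
  - rewrite swap_cocycle_fix // add0r /b'.
    rewrite ifF; last first.
      apply/negbTE/negP => /eqP mi; apply: nC.
      by rewrite /C/preimage/mkset -iterzD mi (_ : _ + _ = 0) //; lia.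
    rewrite ifF //; apply/negbTE/negP => /eqP mj; apply: nC'.
    by rewrite /C/preimage/mkset -!iterzD mj (_ : _ + _ = 0) // /n; lia.
have b'M m : m < - M%:Z \/ M%:Z <= m -> b' m = (0 <= m).
  by move=> mM; rewrite /b' !ifF ?bM //; apply/negbTE; lia.
have b'i : b' (- i%:Z - 1) = false by rewrite /b' eqxx.
have b'j : b' j%:Z = true.
  by rewrite /b' eqxx ifF //; apply/negbTE; lia.
have c1 : ups b M = (ups b' M).+1.
  rewrite /ups (bigD1 i) //= bi add1n [in RHS](bigD1 i) //= b'i add0n.
  congr (_.+1); apply: eq_bigr => i0 i0i; congr nat_of_bool; rewrite /b' !ifF //.
    by apply/negbTE; lia.
  by apply/negbTE; move: i0i; rewrite -val_eqE /=; lia.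
have c2 : downs b M = (downs b' M).+1.
  rewrite /downs (bigD1 j) //= bj add1n [in RHS](bigD1 j) //= b'j add0n.
  congr (_.+1); apply: eq_bigr => j0 j0j; congr nat_of_bool; rewrite /b' !ifF //.
    by apply/negbTE; move: j0j; rewrite -val_eqE /=; lia.
  by apply/negbTE; lia.
have [||||P GP UP] := IH (U * S)%g b'; [by lia|exact: Ub'|exact: b'M|by lia|].
exists (S * P)%g; last by rewrite mulgA.
apply: (subgroupM (generated_subgroupP _)) => //.
by apply: subset_generated_subgroup; exists C, n.
Qed.

End crossings.
Arguments swaps {R d X mu} T.

Section uncrossing.
Context (R : realType) d (X : measurableType d) (mu : probability X R).
Context (T : mp_aut mu).
Hypothesis T_free : \forall x \ae mu, free_at T x.
Context (phi : X -> R) (mphi : measurable_fun setT phi) (phi_inj : injective phi).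
Implicit Types (U V W S P : L1 T) (A B C : set X) (b : int -> bool).
Local Notation integ h := (mu.-integrable setT (EFin \o h)).
Local Notation it := (iterz (rep T)).
Local Notation act U := (mp_fun (rep (val U))).

Lemma shift_exists (k : int) : exists W : L1 T, \forall x \ae mu, cocycle W x = k.
Proof.
have [||W WE _] := L1_exists T_free (S := mp_pow (rep T) k) (c := fun=> k).
- exact: aeW.
- exact: (@finite_measure_integrable_cst _ _ _ _ setT (k%:~R)).
- by exists W.
Qed.

Lemma shift_index W (k : int) : (\forall x \ae mu, cocycle W x = k) ->
  L1_index W = k%:~R.
Proof.
move=> Wk; rewrite /L1_index (@ae_eq_Rintegral _ _ _ _ _ (cst k%:~R)).
- rewrite Rintegral_cst // [X in _ * X](_ : _ = 1) ?mulr1 //.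
  by rewrite (_ : 1 = fine 1%E) //; congr fine; exact: probability_setT.
- exact: cocycle_integ.
- exact: (@finite_measure_integrable_cst _ _ _ _ setT (k%:~R)).
- by apply: filterS Wk => x ->.
Qed.

Lemma jumps_shift U A b W (k : int) : jumps U A b ->
  (\forall x \ae mu, cocycle W x = - k) ->
  jumps (U * W)%g A (fun m => b (m - k)).
Proof.
move=> Ub Wk.
apply: filterS3 Ub (ae_orbit (rep T) Wk)
  (ae_orbit (rep T) (filterI (cocycleM T_free U W) (cocycle_act W))).
move=> x Ub Wx cUW Ax m; have [-> ->] := cUW m; rewrite Wx -iterzD.
by rewrite addrCA addrC [m + _]addrC Ub // addrC.
Qed.

(** By sublinearity almost every point has a jump pattern determined by finitely
    many bits. There are countably many such patterns, so one of them is shared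
    by a set of positive measure. *)
Lemma exists_jumps U : exists M b A, [/\ measurable A, (0 < mu A)%E,
  forall m : int, m < - M%:Z \/ M%:Z <= m -> b m = (0 <= m) &
  forall x, A x -> forall m : int, (0 <= m + cocycle U (it m x)) = b m].
Proof.
pose b (c : nat * seq bool) (m : int) :=
  if (- c.1%:Z <= m) && (m < c.1%:Z) then nth false c.2 (absz (m + c.1%:Z)%R) else 0 <= m.
pose A c := [set x | forall m : int, (0 <= m + cocycle U (it m x)) = b c m].
have mA c : measurable (A c).
  have -> : A c = ~` \bigcup_(m in [set: int])
      (it m @^-1` [set y | (0 <= m + cocycle U y) != b c m]).
    apply/seteqP; split=> [x Ax [m _ /=]|x nAx m]; first by rewrite Ax eqxx.
    by apply/eqP; rewrite -[_ == _]negbK; apply/negP => ne; apply: nAx; exists m.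
  apply: measurableC; apply: countable_bigcup_measurable => m _.
  apply: measurable_iterz_pre.
  exact: (measurable_cocycle U (fun n => (0 <= m + n) != b c m)).
have [|[M s] c0] := ae_exists_pos (mu := mu) mA; last first.
  exists M, (b (M, s)), (A (M, s)); split=> // m mM; rewrite /b ifF //=.
  by apply/negbTE; lia.
apply: filterS (cocycle_sublinear U) => x [M hM].
pose s := mkseq (fun i => 0 <= (i%:Z - M%:Z) + cocycle U (it (i%:Z - M%:Z) x)) (2 * M).
exists (M, s) => m; rewrite /b /=; case: ifP => mM.
  rewrite nth_mkseq; last lia.
  by rewrite (_ : (absz (m + M%:Z)%R)%:Z - M%:Z = m) //; lia.
have := hM m; lia.
Qed.

(** Translating by [k] moves [k] points across the origin, which makes up for
    the excess of forward over backward jumps. *)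
Lemma shift_balanced b (M : nat) :
  (forall m : int, m < - M%:Z \/ M%:Z <= m -> b m = (0 <= m)) ->
  exists (k : int) (M' : nat),
    ups (fun m => b (m - k)) M' = downs (fun m => b (m - k)) M' /\
    forall m : int, m < - M'%:Z \/ M'%:Z <= m -> b (m - k) = (0 <= m).
Proof.
(* [t] counts the points of the window that are sent to the future *)
move=> bM; pose t := (\sum_(0 <= n < 2 * M) b (n%:Z - M%:Z)%R)%N.
have tM : (t <= 2 * M)%N.
  rewrite /t -[X in (_ <= X)%N]subn0 -[X in (_ <= X)%N]muln1 -sum_nat_const_nat.
  by apply: leq_sum => n _; case: (b _).
pose k := t%:Z - M%:Z; pose M' := (M + absz k)%N.
have out (m : int) : m < - M'%:Z \/ M'%:Z <= m -> b (m - k) = (0 <= m).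
  by move=> mM; rewrite bM; rewrite /M' in mM; lia.
exists k, M'; split=> //.
pose r := absz (M'%:Z + k - M%:Z)%R; pose s := absz (M'%:Z - k - M%:Z)%R.
have rE : r%:Z = M'%:Z + k - M%:Z by rewrite /r /M'; lia.
have sE : s%:Z = M'%:Z - k - M%:Z by rewrite /s /M'; lia.
have total : (\sum_(0 <= n < 2 * M') b (n%:Z - M'%:Z - k)%R)%N = M'.
  have -> : (2 * M' = r + (2 * M + s))%N by lia.
  rewrite (big_cat_nat (n := r)) //=; last by lia.
  rewrite big_nat_cond big1 ?add0n; last first.
    move=> n /andP[/andP[_ nr] _]; rewrite bM; first by lia.
    by left; lia.
  rewrite -{1}[r]add0n big_addn addKn.
  rewrite (big_cat_nat (n := 2 * M)) //=; last by lia.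
  rewrite (eq_bigr (fun n => nat_of_bool (b (n%:Z - M%:Z)))); last first.
    by move=> n _; congr (nat_of_bool (b _)); lia.
  rewrite -/t -{1}[(2 * M)%N]add0n big_addn addKn.
  rewrite (eq_bigr (fun=> 1%N)); last first.
    by move=> n _; rewrite bM; [|right]; lia.
  rewrite sum_nat_const_nat; rewrite /k in rE sE; lia.
pose b' m := b (m - k).
have upsE : ups b' M' = (\sum_(i < M') b' (i%:Z - M'%:Z)%R)%N.
  rewrite /ups (reindex_inj rev_ord_inj) /=; apply: eq_bigr => i _.
  by congr (nat_of_bool (b' _)); have := ltn_ord i; lia.
have downsE : (downs b' M' + \sum_(j < M') b' j%:Z = M')%N.
  rewrite /downs -big_split /= (eq_bigr (fun=> 1%N)); last first.
    by move=> j _; case: (b' _).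
  by rewrite sum1_card card_ord.
rewrite -/b'; suff : (ups b' M' + \sum_(j < M') b' j%:Z = M')%N by lia.
rewrite upsE -[RHS]total (big_cat_nat (n := M')) //=; last by lia.
rewrite big_mkord; congr (_ + _)%N.
rewrite [RHS](@big_addn _ _ _ 0 (2 * M') M') (_ : (2 * M' - M' = M')%N); last lia.
by rewrite big_mkord; apply: eq_bigr => j _; congr (nat_of_bool (b _)); lia.
Qed.

Lemma uncrossing U : exists (A : set X) (P W : L1 T) (k : int),
  [/\ measurable A, (0 < mu A)%E, generated_subgroup (swaps T) P,
      \forall x \ae mu, cocycle W x = - k &
      jumps (U * W * P)%g A (fun m => 0 <= m)].
Proof.
have [M [b [A0 [mA0 A00 bM A0b]]]] := exists_jumps U.
have [k [M' [bal out]]] := shift_balanced bM.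
have [A [mA AA0 A00' sA]] := exists_spaced T_free mphi phi_inj (2 * M') mA0 A00.
have [W WE] := shift_exists (- k).
have Ub : jumps U A b by apply: aeW => x /AA0; exact: A0b.
have [P GP UP] := balanced_uncross T_free mA sA (jumps_shift Ub WE) out bal.
by exists A, P, W, k.
Qed.

End uncrossing.

(** * Elements that preserve the intervals cut out by a set *)

Section interval_preserving.
Context (R : realType) d (X : measurableType d) (mu : probability X R).
Context (T : mp_aut mu).
Hypothesis T_free : \forall x \ae mu, free_at T x.
Hypothesis T_ergodic : ergodic T.
Implicit Types (U V W S P Q : L1 T) (A B C : set X).
Local Notation it := (iterz (rep T)).
Local Notation act U := (mp_fun (rep (val U))).
Local Notation future := (fun m : int => 0 <= m).

Lemma preserving_inv V A : jumps V A future -> jumps V^-1%g A future.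
Proof.
move=> VA; have cVV := cocycleM T_free V V^-1%g; rewrite mulgV in cVV.
apply: filterS3 VA (ae_orbit (rep T) (filterI cVV (cocycle_act V^-1%g)))
  (ae_orbit (rep T) (cocycle1 T_free)) => x VA cV c1 Ax m.
have [E1 E2] := cV m; move: E1; rewrite c1 E2 -iterzD.
set q := cocycle V^-1%g _ => E1; have := VA Ax (q + m).
have -> : cocycle V (it (q + m) x) = - q by apply/eqP; rewrite -addr_eq0 -E1.
by rewrite [m + q]addrC => <-; congr (0 <= _); lia.
Qed.

(** The two bounds are the hypothesis at the two ends of the interval. *)
Lemma preserving_stays V A : jumps V A future ->
  \forall x \ae mu, forall p r m : int, A (it p x) -> A (it r x) ->
    p <= m < r -> p <= m + cocycle V (it m x) < r.
Proof.
move=> VA; apply: filterS (ae_orbit (rep T) VA) => x VAx p r m Ap Ar /andP[pm mr].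
have := VAx p Ap (m - p); have := VAx r Ar (m - r).
rewrite -!iterzD !subrK; lia.
Qed.

Lemma orbit_visits A : measurable A -> (0 < mu A)%E ->
  \forall x \ae mu, (exists n : nat, A (it (- n%:Z) x)) /\
    (exists n : nat, A (it n.+1%:Z x)).
Proof.
move=> mA A0.
have rec := ergodic_recurrent T_ergodic mA A0.
apply: filterS2 rec (mp_ae (mp_pow (rep T) 1) rec) => x [_ [n An]] [[m Am] _].
split; first by exists n.
have {}Am : A (it m (it 1 x)) := Am.
by exists m; move: Am; rewrite -iterzD intS addrC.
Qed.

(** Almost every point lies in a finite interval between a past and a future
    visit of its orbit to [A], and its orbit under [V] stays there. *)
Lemma preserving_periodic V A : measurable A -> (0 < mu A)%E ->
  jumps V A future -> is_periodic (val V).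
Proof.
move=> mA A0 VA; have sV := preserving_stays VA.
have sVi := preserving_stays (preserving_inv VA).
have aV := ae_orbit (rep T) (cocycle_act V).
have aVi := ae_orbit (rep T) (cocycle_act V^-1%g).
have iV : \forall x \ae mu, act V^-1%g x = mp_inv (rep (val V)) x.
  exact: (rep_pi (mp_opp (rep (val V)))).
apply: filterS (filterI (filterI (orbit_visits mA A0) (ae_orbit (rep T) iV))
  (filterI (filterI sV sVi) (filterI aV aVi))).
move=> x [[[[n An] [n' An']] {}iV] [[{}sV {}sVi] [{}aV {}aVi]]].
pose F := (fun i : nat => it (i%:Z - n%:Z) x) @` `I_(n + n'.+1).
have finF : finite_set F by apply: finite_image; exact: finite_II.
have FE y : F y <-> exists2 m : int, - n%:Z <= m < n'.+1%:Z & y = it m x.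
  split=> [[i /= ilt <-]|[m mlt ->]]; first by exists (i%:Z - n%:Z) => //; lia.
  exists (absz (m + n%:Z)%R); first by rewrite /=; lia.
  by congr (it _ x); lia.
apply: sub_finite_set finF => _ [k _ <-].
have Fx : F x by apply/FE; exists 0; [lia|].
elim/int_rec: k => [//|k IH|k IH].
- rewrite intS iterz_succ; have /FE[m mlt ->] := IH; apply/FE.
  exists (m + cocycle V (it m x)); first exact: sV.
  by rewrite aV -iterzD addrC.
- rewrite (_ : - k.+1%:Z = - k%:Z - 1); last lia.
  rewrite iterz_pred; have /FE[m mlt ->] := IH; apply/FE.
  exists (m + cocycle V^-1%g (it m x)); first exact: sVi.
  by rewrite -iV aVi -iterzD addrC.
Qed.

(** A permutation of the levels of a tower, being a product of transpositions,
    is realized by a product of swaps. *)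
Lemma tower_perm B (r : nat) (s : {perm 'I_r}) : measurable B -> spaced T B r ->
  exists2 Q : L1 T, generated_subgroup (swaps T) Q &
    \forall x \ae mu,
      (forall i : 'I_r, B (it (- i%:Z) x) -> cocycle Q x = (s i)%:Z - i%:Z) /\
      ((forall i : 'I_r, ~ B (it (- i%:Z) x)) -> cocycle Q x = 0).
Proof.
move=> mB sB; have sG := generated_subgroupP (swaps T).
have level x (i k : int) : B (it (- i) x) -> B (it (- k) x) ->
    i = k \/ r%:Z <= `|i - k|.
  move=> Bi Bk; have : B (it (i - k) (it (- i) x)).
    by rewrite -iterzD addrAC subrr add0r.
  by move=> /(spacedP sB Bi); lia.
have [ts -> _] := prod_tpermP s; elim: ts => [|[i j] ts [Q GQ QE]].
  exists 1%g; first exact: (subgroup1 sG).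
  apply: filterS (cocycle1 T_free) => x ->; rewrite big_nil.
  by split=> // i _; rewrite perm1 subrr.
rewrite big_cons /=; set s' := (\prod_(t <- ts) _)%g in QE *.
have [iltr jltr] := (ltn_ord i, ltn_ord j).
have [->|ij] := eqVneq i j.
  exists Q => //; suff -> : tperm j j = 1%g :> {perm 'I_r} by rewrite mul1g.
  by apply/permP => k; rewrite permE /= perm1; case: eqP => [->|].
pose C := it (- i%:Z) @^-1` B; pose n := j%:Z - i%:Z.
have nij : i%:Z <> j%:Z by move=> [/val_inj/eqP]; rewrite (negbTE ij).
have mC : measurable C by exact: measurable_iterz_pre.
have dC : displaced T C n.
  move=> x Cx Cnx; have {}Cnx : B (it (- (i%:Z - n)) x).
    by move: Cnx; rewrite /C/preimage/mkset -iterzD (_ : - (i%:Z - n) = - i%:Z + n) //; lia.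
  by have := level _ _ _ Cx Cnx; rewrite /n; lia.
have [S sS] := swap_exists T_free mC dC; have [_ _ SE] := sS.
exists (Q * S)%g.
  apply: (subgroupM sG) => //; apply: subset_generated_subgroup.
  by exists C, n.
have Sx := mp_ae (rep (val S)) QE.
apply: filterS (filterI (filterI Sx SE) (filterI (cocycleM T_free Q S) (cocycle_act S))).
move=> x [[{}Sx {}SE] [-> aS]]; rewrite {}aS SE in Sx *.
have lev (k : 'I_r) (l : int) : B (it (- k%:Z) x) -> B (it (- l) x) ->
    0 <= l < r%:Z -> k%:Z = l.
  by move=> Bk Bl; have := level _ _ _ Bk Bl; have := ltn_ord k; lia.
have [Sx1 Sx2] := Sx.
split=> [k Bk|nB].
  have tk : swap_cocycle T C n x = (tperm i j k)%:Z - k%:Z.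
    case: (swapP T C n x) => [Cx|y Cy xE|nC nC'].
    - rewrite swap_cocycle_in // /n; have := lev k i Bk Cx; rewrite ltz_nat iltr => /(_ isT).
      by move=> [/val_inj ->]; rewrite tpermL.
    - rewrite xE swap_cocycle_out //; have : B (it (- j%:Z) x).
        by rewrite xE -iterzD (_ : - j%:Z + n = - i%:Z) //; rewrite /n; lia.
      move=> /(lev k j Bk); rewrite ltz_nat jltr => /(_ isT) [/val_inj ->].
      by rewrite tpermR /n; lia.
    - rewrite swap_cocycle_fix // tpermD ?subrr //.
      + by apply/eqP => ik; apply: nC; rewrite /C/preimage/mkset ik.
      + apply/eqP => jk; apply: nC'; rewrite /C/preimage/mkset -iterzD.
        by rewrite (_ : - i%:Z - n = - k%:Z) //; rewrite -jk /n; lia.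
  rewrite (Sx1 (tperm i j k)); first by rewrite tk permM; lia.
  by rewrite tk -iterzD (_ : _ + _ = - k%:Z) //; lia.
have c0 : swap_cocycle T C n x = 0.
  case: (swapP T C n x) => [Cx|y Cy xE|nC nC']; first by case: (nB i).
  - case: (nB j); rewrite xE -iterzD (_ : - j%:Z + n = - i%:Z) //; rewrite /n; lia.
  - exact: swap_cocycle_fix.
by rewrite c0 in Sx2 *; rewrite addr0; exact: Sx2.
Qed.

(** Each interval between consecutive points of [A] has a length and a
    permutation induced by [V]; there are countably many such types, and the
    restriction of [V] to the intervals of one type is a tower permutation. *)
Lemma preserving_closure V A : measurable A -> (0 < mu A)%E ->
  jumps V A future -> closure (generated_subgroup (swaps T)) V.
Proof.
move=> mA A0 VA; have sG := generated_subgroupP (swaps T).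
have sV := preserving_stays VA.
pose code := (nat * seq int)%type.
(* the left ends of the intervals of length [c.1] on which the cocycle of [V]
   takes the values listed in [c.2] *)
pose B (c : code) := [set a | A a /\ [/\ A (it c.1 a),
  forall l : nat, (0 < l < c.1)%N -> ~ A (it l a) &
  forall i : nat, (i < c.1)%N -> cocycle V (it i a) = nth 0 c.2 i]].
have mB c : measurable (B c).
  have -> : B c = A `&` (it c.1 @^-1` A `&`
      ((~` \bigcup_(l in [set l : nat | (0 < l < c.1)%N]) (it l @^-1` A)) `&`
      (~` \bigcup_(i in [set i : nat | (i < c.1)%N])
         (it i @^-1` [set y | cocycle V y <> nth 0 c.2 i])))).
    apply/seteqP; split=> [a [Aa [Ar nA cV]]|a [Aa [Ar [nA cV]]]].
      split=> //; split=> //; split=> [[l /nA //]|[i /cV /= h]]; exact.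
    split=> //; split=> // [l lr Al|i ir]; first by apply: nA; exists l.
    by apply: contrapT => ne; apply: cV; exists i.
  apply: measurableI => //; apply: measurableI; first exact: measurable_iterz_pre.
  apply: measurableI; apply: measurableC; apply: bigcup_measurable => i _.
    exact: measurable_iterz_pre.
  apply: measurable_iterz_pre.
  exact: (measurable_cocycle V (fun n => n <> nth 0 c.2 i)).
have spB c : spaced T (B c) c.1.
  by move=> x l [_ [_ nA _]] /nA nAl [Al].
pose E (c : code) := [set x | exists2 i : nat, (i < c.1)%N & B c (it (- i%:Z) x)].
have baseuniq c c' x (i i' : nat) : (i < c.1)%N -> (i' < c'.1)%N ->
    B c (it (- i%:Z) x) -> B c' (it (- i'%:Z) x) -> i = i'.
  move=> ir ir' Bi Bi'.
  have aux (u v : nat) c0 : (v < c0.1)%N -> (u < v)%N -> A (it (- u%:Z) x) ->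
      B c0 (it (- v%:Z) x) -> False.
    move=> vr uv Au [_ [_ nA _]]; apply: (nA (v - u)%N); first lia.
    by rewrite -iterzD (_ : _ + _ = - u%:Z) //; lia.
  have [ii'|i'i|//] := ltngtP i i'.
    by case: (aux _ _ _ ir' ii' _ Bi'); case: Bi.
  by case: (aux _ _ _ ir i'i _ Bi); case: Bi'.
(* If no point of the base behaves as almost every point does, the base is null
   and the identity works. *)
have tower c : size c.2 = c.1 -> exists2 Q, generated_subgroup (swaps T) Q &
    \forall x \ae mu, (E c x -> cocycle Q x = cocycle V x) /\
      (~ E c x -> cocycle Q x = 0).
  move=> szc.
  have [[a [fa aV [Aa [Ar nA cV]]]]|noB] := pselect (exists a,
      [/\ free_at T a, (forall p r m : int, A (it p a) -> A (it r a) ->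
        p <= m < r -> p <= m + cocycle V (it m a) < r) /\
        (forall m n : int, m + cocycle V (it m a) = n + cocycle V (it n a) -> m = n)
        & B c a]).
    have [stay inj] := aV.
    have sP (i : 'I_c.1) : (absz (i%:Z + nth 0 c.2 i)%R < c.1)%N.
      have := stay 0 c.1%:Z i Aa Ar; rewrite cV ?ltn_ord //; have := ltn_ord i; lia.
    have s0 (i : 'I_c.1) : 0 <= i%:Z + nth 0 c.2 i.
      have := stay 0 c.1%:Z i Aa Ar; rewrite cV ?ltn_ord //; have := ltn_ord i; lia.
    pose s (i : 'I_c.1) := Ordinal (sP i).
    have sinj : injective s.
      move=> i j /(congr1 val) /= sij; apply/val_inj => /=.
      have : i%:Z = j%:Z.
        apply: inj; rewrite !cV ?ltn_ord //.
        by rewrite -(gez0_abs (s0 i)) -(gez0_abs (s0 j)) sij.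
      by case.
    have [Q GQ QE] := tower_perm (perm sinj) (mB c) (spB c).
    exists Q => //; apply: filterS QE => x [Q1 Q2]; split=> [[i ir Bi]|nE].
      have sE : (s (Ordinal ir))%:Z = i%:Z + nth 0 c.2 i := gez0_abs (s0 (Ordinal ir)).
      rewrite (Q1 (Ordinal ir) Bi) permE sE.
      by have [_ [_ _ /(_ i ir)]] := Bi; rewrite iterzNK => ->; rewrite addrAC subrr add0r.
    by apply: Q2 => i Bi; apply: nE; exists i.
  exists 1%g; first exact: (subgroup1 sG).
  have aV := ae_orbit (rep T) (cocycle_act V).
  apply: filterS2 (ae_orbit (rep T) (filterI T_free (filterI sV aV)))
    (cocycle1 T_free) => x hx ->; split=> // -[i ir Bi].
  exfalso; apply: noB; exists (it (- i%:Z) x); have [f [st av]] := hx (- i%:Z).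
  split=> //; split=> // m n mn; apply: (free_iterz_inj f).
  apply: (can_inj (@mp_funK _ _ _ _ (rep (val V)))).
  by rewrite !av -(iterzD _ _ m) -(iterzD _ _ n) [_ + m]addrC mn addrC.
have /choice[Q QP] : forall n : nat, exists Q : L1 T,
    generated_subgroup (swaps T) Q /\
    \forall x \ae mu, if pickle_inv n is Some c then
      (E c x /\ size c.2 = c.1 -> cocycle Q x = cocycle V x) /\
      (~ (E c x /\ size c.2 = c.1) -> cocycle Q x = 0)
    else cocycle Q x = 0.
  move=> n; case: (pickle_inv n) => [c|]; last first.
    by exists 1%g; split; [exact: (subgroup1 sG)|exact: cocycle1].
  have [szc|szc] := eqVneq (size c.2) c.1.
    have [Q GQ QE] := tower c szc; exists Q; split=> //.
    by apply: filterS QE => x [Q1 Q2]; split=> [[/Q1]//|nE]; apply: Q2 => Ex; apply: nE.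
  exists 1%g; split; first exact: (subgroup1 sG).
  by apply: filterS (cocycle1 T_free) => x ->; split=> // -[_ /eqP]; rewrite (negbTE szc).
pose F n x := exists2 c, pickle_inv n = Some c & E c x /\ size c.2 = c.1.
have QF : \forall x \ae mu, forall n,
    (F n x -> cocycle (Q n) x = cocycle V x) /\ (~ F n x -> cocycle (Q n) x = 0).
  apply: ae_all_count => n; have [_] := QP n; apply: filterS => x; rewrite /F.
  case: (pickle_inv n) => [c [h1 h2]|h]; last by split=> // -[].
  split=> [[c' [<-] /h1//]|nF]; apply: h2 => Ec; apply: nF; by exists c.
have Funiq m n x : F m x -> F n x -> m = n.
  move=> [c mc [[i ir Bi] szc]] [c' nc [[i' ir' Bi'] szc']].
  suff cc' : c = c'.
    have : oapp pickle m (pickle_inv m : option code) = m := pickle_invK m.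
    have : oapp pickle n (pickle_inv n : option code) = n := pickle_invK n.
    by rewrite mc nc /= cc' => <- <-.
  have ii' := baseuniq _ _ _ _ _ ir ir' Bi Bi'; rewrite -ii' in ir' Bi'.
  have [Aa [Ar nA cV]] := Bi; have [_ [Ar' nA' cV']] := Bi'.
  have rr' : c.1 = c'.1.
    have [rr|rr|//] := ltngtP c.1 c'.1; exfalso.
      by apply: (nA' c.1) => //; rewrite rr (leq_ltn_trans _ ir).
    by apply: (nA c'.1) => //; rewrite rr (leq_ltn_trans _ ir').
  case: c c' rr' szc szc' {mc nc Bi Bi' ir ir' Ar Ar' nA nA'} cV cV' => [r p] [r' p'] /=.
  move=> rr' szp szp' cV cV'; congr (_, _) => //.
  apply: (@eq_from_nth _ 0) => [|k]; first by rewrite szp szp'.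
  by rewrite szp => kr; rewrite -cV // -cV' // -rr'.
pose W := fix W n : L1 T := if n is n'.+1 then (W n' * Q n')%g else 1%g.
have GW n : generated_subgroup (swaps T) (W n).
  elim: n => [|n IH]; first exact: (subgroup1 sG).
  by apply: (subgroupM sG IH); have [] := QP n.
have FV : \forall x \ae mu, forall n, F n x -> F n (it (cocycle V x) x).
  apply: filterS (ae_orbit (rep T) sV) => x st n [c nc [[i ir Bi] szc]].
  exists c => //; split=> //.
  have [Aa [Ar nA cV]] := Bi.
  have := st (- i%:Z) 0 c.1 i Aa Ar; rewrite iterzNK => h.
  have {}h : 0 <= i%:Z + cocycle V x < c.1%:Z.
    by apply: h; rewrite lez_nat ltz_nat.
  case/andP: h => h1 h2; exists (absz (i%:Z + cocycle V x)%R).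
    by rewrite -ltz_nat gez0_abs.
  by rewrite gez0_abs // -iterzD opprD -addrA addNr addr0.
have WE : \forall x \ae mu, forall n,
    ((exists2 j, (j < n)%N & F j x) -> cocycle (W n) x = cocycle V x) /\
    (~ (exists2 j, (j < n)%N & F j x) -> cocycle (W n) x = 0).
  apply: ae_all_count; elim=> [|n IH].
    apply: filterS (cocycle1 T_free) => x E1; split=> [[]//|_]; exact: E1.
  have IHo := ae_orbit (rep T) IH.
  apply: filterS (filterI (filterI IHo (cocycleM T_free (W n) (Q n)))
    (filterI (cocycle_act (Q n)) (filterI QF FV))).
  move=> x [[{}IHo cWQ] [aQ [{}QF {}FV]]].
  rewrite /= cWQ aQ; have [Q1 Q2] := QF n.
  have [Fx|nFx] := pselect (F n x).
    rewrite Q1 //; have [_ ->] := IHo (cocycle V x); last first.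
      by move=> [j jn Fj]; have := Funiq _ _ _ Fj (FV n Fx); lia.
    by rewrite add0r; split=> // nF; case: nF; exists n.
  rewrite Q2 // addr0; have [h1 h2] := IHo 0; split=> [[j jn Fj]|nF].
    apply: h1; exists j => //; move: jn; rewrite ltnS leq_eqVlt => /orP[/eqP jE|//].
    by case: nFx; rewrite -jE.
  by apply: h2 => -[j jn Fj]; apply: nF; exists j => //; rewrite ltnS ltnW.
apply/closure_distP => e e0.
have [||n Wn] := L1_dist_exhaust (U := V) (V := W) _ _ e0; last by exists (W n).
- apply: filterS WE => x WE n; have [h1 h2] := WE n.
  by have [/h1|/h2] := pselect (exists2 j, (j < n)%N & F j x); [right|left].
- apply: filterS2 WE (orbit_visits mA A0) => x {}WE [exa exr].
  have exa' : exists n : nat, `[< A (it (- n%:Z) x) >].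
    by case: exa => n An; exists n; apply/asboolP.
  case: (ex_minnP exa') => i /asboolP Ai imin.
  have exr' : exists n : nat, `[< A (it n.+1%:Z (it (- i%:Z) x)) >].
    case: exr => n An; exists (n + i)%N; apply/asboolP.
    by rewrite -iterzD (_ : _ + _ = n.+1%:Z) //; lia.
  case: (ex_minnP exr') => r /asboolP Ar rmin.
  pose c : code := (r.+1, mkseq (fun k => cocycle V (it k%:Z (it (- i%:Z) x))) r.+1).
  have ir : (i < r.+1)%N.
    rewrite ltnNge; apply/negP => ri.
    have /imin : `[< A (it (- (i - r.+1)%N%:Z) x) >].
      apply/asboolP; move: Ar; rewrite -iterzD.
      by rewrite (_ : _ + _ = - (i - r.+1)%N%:Z) //; lia.
    lia.
  have Bc : B c (it (- i%:Z) x).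
    split=> //; split=> // [l /andP[l0 lr] Al|k kr]; last by rewrite nth_mkseq.
    have /rmin : `[< A (it l.-1.+1%:Z (it (- i%:Z) x)) >].
      by apply/asboolP; rewrite prednK.
    move: lr => /=; lia.
  have Fc : F (pickle c) x.
    by exists c; [exact: pickleK_inv|split; [exists i|rewrite size_mkseq]].
  exists (pickle c).+1 => n cn; have [h1 _] := WE n.
  by apply: h1; exists (pickle c).
Qed.

End interval_preserving.

(** * The kernel of the index *)

Section index_kernel.
Context (R : realType) d (X : measurableType d) (mu : probability X R).
Context (T : mp_aut mu).
Hypothesis T_free : \forall x \ae mu, free_at T x.
Hypothesis T_ergodic : ergodic T.
Hypothesis mu_nonatomic : nonatomic mu.
Context (phi : X -> R) (mphi : measurable_fun setT phi) (phi_inj : injective phi).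
Hypothesis phi02 : forall x, 0 <= phi x <= 2.
Implicit Types (U V W S P : L1 T).

Local Notation kernel := [set U : L1 T | L1_index U = 0].
Local Notation periodic := [set U : L1 T | is_periodic (val U)].
Local Notation involution := [set U : L1 T | is_involution U].
Local Notation component := (connected_component [set: L1 T] 1%g).

Lemma swaps_sub_involution : swaps T `<=` involution.
Proof. by move=> S [C [n /swap_involution]]. Qed.

Lemma involution_sub_periodic : involution `<=` periodic.
Proof. by move=> U; exact: involution_periodic. Qed.

Lemma periodic_sub_kernel : periodic `<=` kernel.
Proof. by move=> U; exact: periodic_index. Qed.

Lemma swaps_sub_kernel : generated_subgroup (swaps T) `<=` kernel.
Proof.
apply: generated_subgroup_sub; first exact: kernel_subgroup.
by move=> S /swaps_sub_involution/involution_sub_periodic/periodic_sub_kernel.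
Qed.

(** The index can be read off a factorization: [V] and [P] have index 0, and [W]
    acts as the power [- k] of [T]. *)
Lemma index_decomposition U : exists V P W (k : int),
  [/\ [/\ U = (V * P^-1 * W^-1)%g, is_periodic (val V),
      closure (generated_subgroup (swaps T)) V &
      generated_subgroup (swaps T) P], (\forall x \ae mu, cocycle W x = - k) &
      L1_index U = k%:~R].
Proof.
have [A [P [W [k [mA A0 GP Wk UA]]]]] := uncrossing T_free mphi phi_inj U.
have pV := preserving_periodic T_free T_ergodic mA A0 UA.
exists (U * W * P)%g, P, W, k; split=> //.
  split=> //; last exact: preserving_closure UA.
  by rewrite mulgK mulgK.
have := periodic_sub_kernel pV; rewrite /mkset !(L1_indexM T_free).
rewrite (swaps_sub_kernel GP) addr0 (shift_index Wk) intrN => /eqP.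
by rewrite subr_eq0 => /eqP.
Qed.

Lemma kernel_decomposition U : kernel U -> exists V P,
  [/\ U = (V * P^-1)%g, is_periodic (val V),
      closure (generated_subgroup (swaps T)) V &
      generated_subgroup (swaps T) P].
Proof.
have [V [P [W [k [[UE pV cV GP] Wk Uk]]]]] := index_decomposition U.
move=> U0; have /eqP : k%:~R = 0 :> R by rewrite -Uk.
rewrite intr_eq0 => /eqP k0.
exists V, P; split=> //; rewrite UE.
suff -> : W = 1%g by rewrite invg1 mulg1.
apply: act_eq_cocycle.
by apply: filterS2 Wk (cocycle1 T_free) => x -> ->; rewrite k0 oppr0.
Qed.

Lemma kernel_sub_periodic : kernel `<=` generated_subgroup periodic.
Proof.
move=> U /kernel_decomposition [V [P [-> pV _ GP]]].
apply: (subgroup_div (generated_subgroupP _)).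
  exact: subset_generated_subgroup.
apply: generated_subgroup_sub GP; first exact: generated_subgroupP.
move=> S /swaps_sub_involution/involution_sub_periodic.
exact: subset_generated_subgroup.
Qed.

Lemma kernel_sub_closure_swaps : kernel `<=` closure (generated_subgroup (swaps T)).
Proof.
move=> U /kernel_decomposition [V [P [-> _ cV GP]]].
apply: (subgroup_div _ cV); last exact: subset_closure.
by apply: closure_subgroup => //; exact: generated_subgroupP.
Qed.

Lemma kernel_sub_closed (H : set (L1 T)) : subgroup H -> closed H ->
  swaps T `<=` H -> kernel `<=` H.
Proof.
move=> sH cH SH U /kernel_sub_closure_swaps.
have /closure_id -> := cH; apply: closureS.
exact: generated_subgroup_sub.
Qed.

Lemma closure_derivedE : closure (derived_subgroup [set: L1 T]) = kernel.
Proof.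
apply/seteqP; split.
  have /closure_id -> := kernel_closed (T := T); apply: closureS.
  apply: generated_subgroup_sub; first exact: kernel_subgroup.
  move=> _ [U _ [V _ <-]]; rewrite /mkset /commg /conjg.
  rewrite !(L1_indexM T_free) !(L1_indexV T_free).
  by rewrite [- L1_index V + _]addrCA addNr addr0 addNr.
apply: kernel_sub_closed; last 1 first.
- by move=> S [C [n]]; exact: swap_in_closure_derived phi_inj _ _ _.
- by apply: closure_subgroup => //; exact: generated_subgroupP.
- exact: closed_closure.
Qed.

Lemma generated_periodicE : generated_subgroup periodic = kernel.
Proof.
apply/seteqP; split; last exact: kernel_sub_periodic.
apply: generated_subgroup_sub; first exact: kernel_subgroup.
exact: periodic_sub_kernel.
Qed.

Lemma closure_involutionE : closure (generated_subgroup involution) = kernel.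
Proof.
apply/seteqP; split.
  have /closure_id -> := kernel_closed (T := T); apply: closureS.
  apply: generated_subgroup_sub; first exact: kernel_subgroup.
  by move=> U /involution_sub_periodic/periodic_sub_kernel.
apply: kernel_sub_closed; last 1 first.
- move=> S /swaps_sub_involution SI; apply: subset_closure.
  exact: subset_generated_subgroup.
- by apply: closure_subgroup => //; exact: generated_subgroupP.
- exact: closed_closure.
Qed.

(** The index is continuous and takes integer values, so it vanishes on the
    component of the identity. *)
Lemma component_sub_kernel : component `<=` kernel.
Proof.
have ci : continuous (@L1_index R d X mu T).
  move=> U B; rewrite nbhs_simpl -!nbhs_ballE => -[e e0 eB].
  exists e => // V UV; apply: eB.
  by apply: le_lt_trans (L1_index_dist U V) _; exact: UV.
have : connected (@L1_index R d X mu T @` component).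
  apply: connected_continuous_connected; first exact: component_connected.
  exact: continuous_subspaceT.
move=> /connected_intervalP itvI U KU; rewrite /mkset; apply: contrapT => U0.
have I1 : (@L1_index R d X mu T @` component) 0.
  by exists 1%g; [exact: connected_component_refl|exact: L1_index1].
have IU : (@L1_index R d X mu T @` component) (L1_index U) by exists U.
have half (z : R) (j : int) : 2 * z = j%:~R -> odd `|j| ->
    ~ (@L1_index R d X mu T @` component) z.
  move=> zj oj [V _ Vz]; have [_ [_ [_ [k [_ _ Vk]]]]] := index_decomposition V.
  move: zj; rewrite -Vz Vk (_ : 2 = 2%:~R :> R) // -intrM => /intr_inj jE.
  by move: oj; rewrite -jE abszM oddM.
have [_ [_ [_ [k [_ _ Uk]]]]] := index_decomposition U.
have k0 : k != 0 by apply/negP => /eqP k0; apply: U0; rewrite Uk k0.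
have [kp|kn] := leP 0 k.
  have k1 : (1 : R) <= k%:~R by rewrite (ler_int R 1); lia.
  apply: (half (1 / 2) 1) => //; first by rewrite mulrC divfK.
  by apply: (itvI _ _ I1 IU); rewrite Uk; apply/andP; split; lra.
have k1 : k%:~R <= (- 1 : R) by rewrite (_ : - 1 = (- 1)%:~R :> R) ?ler_int ?intrN //; lia.
apply: (half (- (1 / 2)) (- 1)) => //; first by rewrite mulrN mulrC divfK // intrN.
by apply: (itvI _ _ IU I1); rewrite Uk; apply/andP; split; lra.
Qed.

Lemma componentE : component = kernel.
Proof.
apply/seteqP; split; first exact: component_sub_kernel.
apply: kernel_sub_closed; last 1 first.
- by move=> S [C [n]]; exact: swap_component phi_inj phi02 _ _ _.
- exact: component_subgroup.
- by apply: component_closed; exact: closedT.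
Qed.

End index_kernel.

Theorem theorem1p3 (R : realType) (d : measure_display) (X : measurableType d)
    (mu : probability X R) (X_standard : standard_borel R X)
    (mu_nonatomic : nonatomic mu) (T : mp_aut mu) (T_ergodic : ergodic T) :
  [/\ closure (derived_subgroup [set: L1 T]) = [set U : L1 T | L1_index U = 0],
      closure (derived_subgroup [set: L1 T]) = connected_component [set: L1 T] 1%g,
      closure (derived_subgroup [set: L1 T]) =
        generated_subgroup [set U : L1 T | is_periodic (val U)] &
      closure (derived_subgroup [set: L1 T]) =
        closure (generated_subgroup [set U : L1 T | is_involution U])].
Proof.
have [phi [mphi phi_inj phi02]] := standard_borel_injection X_standard.
have T_free := ergodic_free T_ergodic mu_nonatomic mphi phi_inj.
by rewrite (closure_derivedE T_free T_ergodic mphi phi_inj)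
  (componentE T_free T_ergodic mu_nonatomic mphi phi_inj phi02)
  (generated_periodicE T_free T_ergodic mphi phi_inj)
  (closure_involutionE T_free T_ergodic mphi phi_inj).
Qed.
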